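(* Let $n\ge1$ and let $\Omega\subset\mathbb{R}^n$ be an open bounded set. Let $1<p<2$ and, for $i=1,2,3$, let $\alpha_i\in(0,1)$, $q_i\in(p-1,1)$ and $t_i\in(p-1,\infty]$. Assume $0<\theta<1$ satisfies \[ \alpha_1=(1-\theta)\alpha_2+\theta\alpha_3,\qquad \frac1{q_1}=\frac{1-\theta}{q_2}+\frac{\theta}{q_3},\qquad \frac1{t_1}=\frac{1-\theta}{t_2}+\frac{\theta}{t_3}. \] Let $\mathcal{L}$ be the nonlocal operator described in the context. Then there is a constant $C>0$ (independent of $u$) such that \[ \|u\|_{L^{\frac{nq_1}{n-\alpha_1q_1},t_1}(\mathbb{R}^n)}\leq C\,[u]_{W^{\alpha_2,(q_2,t_2)}(\mathbb{R}^n)}^{1-\theta}\,[u]_{W^{\alpha_3,(q_3,t_3)}(\mathbb{R}^n)}^{\theta} \] for all $\mathcal{L}$-superharmonic functions $u$ on $\Omega$ with $u=0$ in $\mathbb{R}^n\setminus\Omega$ for which both seminorms on the right are finite, where $[u]_{W^{\beta,(s,r)}(\mathbb{R}^n)}=\big\|\frac{|u(x)-u(y)|}{|x-y|^{\frac ns+\beta}}\big\|_{L^{s,r}(\mathbb{R}^n\times\mathbb{R}^n)}$.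
   Context: Lorentz quasi-norm: for measurable $f$ on $E$ (in $\mathbb{R}^n$ or $\mathbb{R}^n\times\mathbb{R}^n$, Lebesgue measure), $\mu_f(\beta)=|\{|f|>\beta\}|$, $0<s<\infty$, $0<r\le\infty$: $\|f\|_{L^{s,r}(E)}=\big(s\int_0^\infty[\beta\mu_f(\beta)^{1/s}]^r\frac{d\beta}{\beta}\big)^{1/r}$ if $r<\infty$, and $\sup_{\beta>0}\beta\mu_f(\beta)^{1/s}$ if $r=\infty$. The operator: fix $\Lambda\ge1$, and a symmetric measurable kernel $k$ with $\Lambda^{-1}|x-y|^{-n-\alpha p}\le k(x,y)\le\Lambda|x-y|^{-n-\alpha p}$ for a fixed $\alpha\in(0,1)$; $\mathcal{L}u(x)=2\lim_{\varepsilon\to0}\int_{\mathbb{R}^n\setminus B(x,\varepsilon)}|u(x)-u(y)|^{p-2}(u(x)-u(y))k(x,y)\,dy$. Tail space: $L^{p-1}_{\alpha p}(\mathbb{R}^n)=\{u\in L^{p-1}_{loc}:\int\frac{|u(y)|^{p-1}}{(1+|y|)^{n+\alpha p}}dy<\infty\}$. A weak solution of $\mathcal{L}v=0$ in open $D$: $v\in W^{\alpha,p}_{loc}(D)$, $v_-\in L^{p-1}_{\alpha p}(\mathbb{R}^n)$, $\int\int|v(x)-v(y)|^{p-2}(v(x)-v(y))(\phi(x)-\phi(y))k(x,y)\,dx\,dy=0$ for all $\phi\in C_0^\infty(D)$. $u:\mathbb{R}^n\to(-\infty,\infty]$ is $\mathcal{L}$-superharmonic in $\Omega$ if: (i) $u<\infty$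 a.e.; (ii) $u$ is lower semicontinuous in $\Omega$; (iii) for each open $D$ with $\overline D\subset\Omega$ compact and each weak solution $v\in C(\overline D)$ of $\mathcal{L}v=0$ in $D$ with $v_+\in L^\infty(\mathbb{R}^n)$ and $u\ge v$ on $\partial D$, $u\ge v$ in $D$; (iv) $u_-\in L^{p-1}_{\alpha p}(\mathbb{R}^n)$. *)

(* Defs.v *)
(* Lebesgue (outer) measure on R^n = 'rV[R]_n is
   built here from boxes via the library's measure-extension machinery
   (mu_ext + Caratheodory), since the library only provides it for n = 1. *)
From HB Require Import structures.
From mathcomp Require Import all_boot all_order all_algebra.
From mathcomp Require Import all_classical all_reals all_analysis.
From mathcomp Require Import measurable_realfun.
Set Implicit Arguments. Unset Strict Implicit. Unset Printing Implicit Defensive.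
Import Order.TTheory GRing.Theory Num.Theory.
Import numFieldNormedType.Exports.
Local Open Scope classical_set_scope.
Local Open Scope ring_scope.

Section LebesgueRn.
Context (R : realType) (n : nat).

(* auxiliary copy of R^n carrying the discrete sigma-algebra, only used to
   feed the generic outer-measure construction [mu_ext] *)
Definition RnD : Type := 'rV[R]_n.
HB.instance Definition _ := Choice.on RnD.
HB.instance Definition _ := isPointed.Build RnD 0.
HB.instance Definition _ := @isMeasurable.Build default_measure_display RnD
  (@discrete_measurable RnD) (@discrete_measurable0 RnD)
  (@discrete_measurableC RnD) (@discrete_measurableU RnD).

Definition box (a b : 'rV[R]_n) : set 'rV[R]_n :=
  [set x | forall i, a 0 i <= x 0 i <= b 0 i].
Definition boxvol (a b : 'rV[R]_n) : R := \prod_i Num.max (b 0 i - a 0 i) 0.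

Definition boxmu (A : set RnD) : \bar R :=
  ereal_inf ([set (boxvol ab.1 ab.2)%:E | ab in
               [set ab : 'rV[R]_n * 'rV[R]_n | A `<=` box ab.1 ab.2]]
             `|` [set (0 : \bar R) | _ in [set _ : unit | A = set0]]).

Lemma boxmu_ge0 A : (0 <= boxmu A)%E.
Proof.
apply: le_ereal_inf_tmp => x [[ab _ <-]|[_ _ <-]] //.
rewrite lee_fin /boxvol; apply: prodr_ge0 => i _.
by rewrite le_max lexx orbT.
Qed.

Lemma boxmu0 : boxmu set0 = 0%E.
Proof.
apply/eqP; rewrite eq_le boxmu_ge0 andbT.
by apply: ereal_inf_lbound; right; exists tt.
Qed.

(* Lebesgue outer measure on R^n:
   inf { sum_k |Q_k| : A included in the union of the boxes Q_k } *)
End LebesgueRn.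

HB.lock Definition lebo (R : realType) (n : nat) : set (RnD R n) -> \bar R :=
  mu_ext (@boxmu R n).
Arguments lebo {R n}.

Section LebesgueRn2.
Context (R : realType) (n : nat).
Local Notation RnD := (RnD R n).
Local Notation lebo := (@lebo R n).
Local Notation boxmu := (@boxmu R n).
Local Notation boxmu0 := (@boxmu0 R n).
Local Notation boxmu_ge0 := (@boxmu_ge0 R n).

Lemma lebo0 : lebo set0 = 0%E.
Proof. by rewrite unlock; exact: (mu_ext0 boxmu0 boxmu_ge0). Qed.
Lemma lebo_ge0 A : (0 <= lebo A)%E.
Proof. by rewrite unlock; exact: (mu_ext_ge0 boxmu_ge0). Qed.
Lemma le_lebo : {homo lebo : A B / A `<=` B >-> (A <= B)%E}.
Proof. by rewrite unlock; exact: (le_mu_ext boxmu). Qed.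
Lemma lebo_sigma_subadditive : sigma_subadditive lebo.
Proof. by rewrite unlock; exact: (mu_ext_sigma_subadditive boxmu_ge0). Qed.

HB.instance Definition _ := isOuterMeasure.Build R RnD lebo
  lebo0 lebo_ge0 le_lebo lebo_sigma_subadditive.

Definition Leb := caratheodory_type lebo.
Definition leb : {measure set Leb -> \bar R} :=
  (lebo : {outer_measure set RnD -> \bar R}) : set Leb -> \bar R.

End LebesgueRn2.
Arguments Leb : clear implicits.
Arguments leb : clear implicits.

(* R^n as a normed space (sup-norm topology = Euclidean topology) *)
Definition Rn (R : realType) (n : nat) : normedModType R := 'rV[R]_n.

Section Defs.
Context (R : realType).
Local Open Scope ereal_scope.

Definition enorm n (x : 'rV[R]_n) : R := Num.sqrt (\sum_i x ord0 i ^+ 2).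

Definition einv (t : \bar R) : R :=
  match t with EFin r => r^-1 | _ => 0%R end.

(* R^n x R^n is represented as R^(n+n) = 'rV_(n+n) *)
Definition pairfun n (X : Type) (g : 'rV[R]_n -> 'rV[R]_n -> X)
  : 'rV[R]_(n + n) -> X := fun z => g (lsubmx z) (rsubmx z).
Definition pairset n (A B : set 'rV[R]_n) : set 'rV[R]_(n + n) :=
  [set z | A (lsubmx z) /\ B (rsubmx z)].

Definition Lmeas n (A : set 'rV[R]_n) (f : 'rV[R]_n -> \bar R) :=
  @measurable_fun _ _ (Leb R n) (\bar R) A f.
Definition Lint n (A : set 'rV[R]_n) (f : 'rV[R]_n -> \bar R) : \bar R :=
  @integral _ (Leb R n) R (leb R n) A f.
Definition Lintegrable n (A : set 'rV[R]_n) (f : 'rV[R]_n -> \bar R) :=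
  @integrable _ (Leb R n) R (leb R n) A f.

Definition distrib n (f : 'rV[R]_n -> \bar R) (b : R) : \bar R :=
  lebo [set x : RnD R n | b%:E < `|f x| ].

Definition lorentz n (s : R) (r : \bar R) (f : 'rV[R]_n -> \bar R) : \bar R :=
  match r with
  | +oo => ereal_sup [set b%:E * poweR (distrib f b) s^-1 | b in `]0%R, +oo[]
  | EFin r' =>
      poweR (s%:E * \int[lebesgue_measure]_(b in `]0%R, +oo[)
                (poweR (b%:E * poweR (distrib f b) s^-1) r' * (b^-1)%:E))
            r'^-1
  | -oo => 0
  end.

Definition gag_seminorm n (beta s : R) (r : \bar R) (u : 'rV[R]_n -> \bar R)
  : \bar R :=
  lorentz s r (pairfun (fun x y =>
    `|u x - u y| * ((powR (enorm (x - y)) (n%:R / s + beta))^-1)%:E)).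

Definition tail_space n (p a : R) (f : 'rV[R]_n -> \bar R) :=
  [/\ Lmeas setT f,
      (forall K : set 'rV[R]_n, compact (K : set (Rn R n)) ->
         Lint K (fun x => poweR `|f x| (p - 1)) < +oo) &
      Lint setT (fun y => poweR `|f y| (p - 1) *
         ((powR (1 + enorm y) (n%:R + a * p))^-1)%:E) < +oo].

Definition Wloc n (p a : R) (D : set 'rV[R]_n) (v : 'rV[R]_n -> R) :=
  forall D' : set 'rV[R]_n, open (D' : set (Rn R n)) ->
    compact (closure (D' : set (Rn R n))) ->
    closure (D' : set (Rn R n)) `<=` D ->
    [/\ Lmeas D' (fun x => (v x)%:E),
        Lint D' (fun x => (powR `|v x| p)%:E) < +oo &
        Lint (pairset D' D') (pairfun (fun x y =>
          (powR `|v x - v y| p / powR (enorm (x - y)) (n%:R + a * p))%:E))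
        < +oo].

Fixpoint Ck n (k : nat) (f : 'rV[R]_n -> R) : Prop :=
  match k with
  | 0 => continuous (f : Rn R n -> R)
  | k'.+1 => continuous (f : Rn R n -> R) /\
      forall i : 'I_n,
        (forall x, derivable (f : Rn R n -> R^o) x (delta_mx ord0 i)) /\
        Ck k' (fun x => derive (f : Rn R n -> R^o) x (delta_mx ord0 i))
  end.
Definition smooth n (f : 'rV[R]_n -> R) := forall k, Ck k f.

Definition testfun n (D : set 'rV[R]_n) (phi : 'rV[R]_n -> R) :=
  [/\ smooth phi,
      compact (closure ([set x | phi x != 0%R] : set (Rn R n))) &
      closure ([set x | phi x != 0%R] : set (Rn R n)) `<=` D].

Definition kernel_adm n (Lam a p : R) (k : 'rV[R]_n -> 'rV[R]_n -> R) :=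
  [/\ (forall x y, k x y = k y x),
      @measurable_fun _ _ (Leb R (n + n)) R setT (pairfun k) &
      forall x y, x != y ->
        (Lam^-1 * powR (enorm (x - y)) (- (n%:R + a * p)) <= k x y)%R /\
        (k x y <= Lam * powR (enorm (x - y)) (- (n%:R + a * p)))%R].

Definition weak_solution n (p a : R) (k : 'rV[R]_n -> 'rV[R]_n -> R)
  (D : set 'rV[R]_n) (v : 'rV[R]_n -> R) :=
  [/\ Wloc p a D v,
      tail_space p a (fun x => (Num.max (- v x) 0%R)%:E) &
      forall phi, testfun D phi ->
        let F := pairfun (fun x y =>
          (powR `|v x - v y| (p - 2) * (v x - v y) * (phi x - phi y)
           * k x y)%:E) in
        Lintegrable setT F /\ Lint setT F = 0].

Definition Linfty n (g : 'rV[R]_n -> R) :=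
  Lmeas setT (fun x => (g x)%:E) /\
  exists M : R, lebo [set x : RnD R n | (M < `|g x|)%R] = 0.

Definition superharmonic n (p a : R) (k : 'rV[R]_n -> 'rV[R]_n -> R)
  (Omega : set 'rV[R]_n) (u : 'rV[R]_n -> \bar R) :=
  [/\ lebo [set x : RnD R n | u x = +oo] = 0,
      (forall x : Rn R n, Omega x -> forall t : R, t%:E < u x ->
         \forall y \near x, t%:E < u y),
      (forall D : set 'rV[R]_n, open (D : set (Rn R n)) ->
         compact (closure (D : set (Rn R n))) ->
         closure (D : set (Rn R n)) `<=` Omega ->
         forall v : 'rV[R]_n -> R,
           {within closure (D : set (Rn R n)), continuous (v : Rn R n -> R)} ->
           weak_solution p a k D v ->
           Linfty (fun x => Num.max (v x) 0%R) ->
           (forall x, (closure (D : set (Rn R n)) `\` D) x -> (v x)%:E <= u x) ->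
           forall x, D x -> (v x)%:E <= u x) &
      tail_space p a (fun x => maxe (- u x) 0)].

End Defs.

(* Main.v *)
Require Import Defs.
From HB Require Import structures.
From mathcomp Require Import all_boot all_order all_algebra.
From mathcomp Require Import all_classical all_reals all_analysis.
From mathcomp Require Import measurable_realfun ring lra.
Import Order.TTheory GRing.Theory Num.Theory.
Import numFieldNormedType.Exports.
Local Open Scope classical_set_scope.
Local Open Scope ring_scope.

(** Let [a k] be the measure of [{|u| > l0 2^k}].  If [|u x| > l0 2^(k+1)], then
    at least half of a cube of measure [2 a k] around [x] consists of points [y]
    with [|u y| <= l0 2^k], so the difference quotient exceeds a constant times
    [l0 2^k (a k)^-(1/q + alpha/n)] on a set of measure at least [a k * a (k+1)].
    These thresholds at least double with [k], so the [L^(q,t)] norm of the quotient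
    controls the [l^t] norm of
    [G k = l0 2^(k+1) (a (k+1))^(1/q) (a k)^(-alpha/n)].  In [1/q] and [alpha]
    the sequence [G] is exactly log-linear, so the interpolation is Hoelder's
    inequality for sequences.  Finally [F k = l0 2^k (a k)^(1/q - alpha/n)], whose
    [l^t] norm is the Lorentz norm of [u], satisfies
    [F (k+1) <= max (d * F k, C * G k)] with [d < 1]; bounded support makes
    [F 0] vanish as [l0] tends to [0]. *)

Set Implicit Arguments.
Unset Strict Implicit.

(** * Truncated sequence norms, Hoelder's inequality and the level recursion *)

Section Sequences.
Context {R : realType}.
Implicit Types (x y : nat -> R) (X Y N : R) (K : nat) (t : \bar R).

(** A bound on the [l^t] norm of a finite truncation. It is stated as a relation between [t]-th
    powers, so that no root is taken and the supremum case has the same interface. Truncation keeps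
    every sum finite, which the absorption in [levF_summation] requires. *)
Definition seqnorm_le t N K x : Prop :=
  match t with
  | EFin r => \sum_(k < K) x k `^ r <= N `^ r
  | _ => forall k, (k < K)%N -> x k <= N
  end.

Lemma powR_le_inv (r u v : R) : 0 < r -> 0 <= u -> 0 <= v ->
  u `^ r <= v `^ r -> u <= v.
Proof.
move=> r0 u0 v0 uv; rewrite leNgt; apply/negP => vu.
by move: uv; rewrite leNgt gt0_ltr_powR.
Qed.

Lemma seqnorm_le_pointwise t N K x k : (0%:E < t)%E -> 0 <= N ->
  (forall k, 0 <= x k) -> seqnorm_le t N K x -> (k < K)%N -> x k <= N.
Proof.
case: t => [r| |] //= r0 N0 x0 h kK; last exact: h.
apply: (@powR_le_inv r) => //; apply: le_trans h.
rewrite (bigD1 (Ordinal kK))//= lerDl.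
by apply: sumr_ge0 => i _; exact: powR_ge0.
Qed.

Lemma seqnorm_le_scale t N K x : (0%:E < t)%E -> 0 < N ->
  (forall k, 0 <= x k) ->
  seqnorm_le t N K x <-> seqnorm_le t 1 K (fun k => x k / N).
Proof.
case: t => [r| |] //= r0 N0 x0.
  rewrite powR1 [X in _ <-> (is_true (X <= _))](eq_bigr
    (fun k : 'I_K => x k `^ r / N `^ r)); last first.
    move=> k _; rewrite powRM// ?invr_ge0 ?(ltW N0)//.
    by rewrite -[N^-1]powR_inv1 ?(ltW N0)// -powRrM mulN1r powRN.
  by rewrite -mulr_suml ler_pdivrMr ?mul1r// powR_gt0.
by split=> h k kK; move: (h k kK); rewrite ler_pdivrMr// mul1r.
Qed.

Lemma seqnorm_le_holder t1 t2 t3 (theta : R) X Y K x y :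
  (0%:E < t1)%E -> (0%:E < t2)%E -> (0%:E < t3)%E -> 0 < theta < 1 ->
  einv t1 = (1 - theta) * einv t2 + theta * einv t3 ->
  0 <= X -> 0 <= Y -> (forall k, 0 <= x k) -> (forall k, 0 <= y k) ->
  seqnorm_le t2 X K x -> seqnorm_le t3 Y K y ->
  seqnorm_le t1 (X `^ (1 - theta) * Y `^ theta) K
    (fun k => x k `^ (1 - theta) * y k `^ theta).
Proof.
move=> t1_gt0 t2_gt0 t3_gt0 /andP[th0 th1] tE X0 Y0 x0 y0 hx hy.
have th1' : 0 < 1 - theta by rewrite subr_gt0.
have G0 k : 0 <= x k `^ (1 - theta) * y k `^ theta.
  by rewrite mulr_ge0 ?powR_ge0.
(* A zero bound cannot be divided out. It forces its sequence, hence the product, to vanish below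
   [K]. *)
have seq0 t (z : nat -> R) : (0%:E < t)%E -> (forall k, (k < K)%N -> z k = 0) ->
    seqnorm_le t 0 K z.
  case: t => [r| |] //= r0 z0; last by move=> k /z0->.
  by rewrite big1 ?powR_ge0// => i _; rewrite z0 ?powR0// gt_eqF.
have [X_eq0|X_neq0] := eqVneq X 0.
  rewrite X_eq0 powR0 ?gt_eqF// mul0r; apply: seq0 => // k kK.
  have := seqnorm_le_pointwise t2_gt0 X0 x0 hx kK; rewrite X_eq0 => xk.
  by rewrite (_ : x k = 0) ?powR0 ?mul0r ?gt_eqF//; apply/le_anti; rewrite xk x0.
have [Y_eq0|Y_neq0] := eqVneq Y 0.
  rewrite Y_eq0 [0 `^ _]powR0 ?gt_eqF// mulr0; apply: seq0 => // k kK.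
  have := seqnorm_le_pointwise t3_gt0 Y0 y0 hy kK; rewrite Y_eq0 => yk.
  by rewrite (_ : y k = 0) ?[0 `^ _]powR0 ?mulr0 ?gt_eqF//;
    apply/le_anti; rewrite yk y0.
have {X0 X_neq0}X0 : 0 < X by rewrite lt_neqAle eq_sym X_neq0.
have {Y0 Y_neq0}Y0 : 0 < Y by rewrite lt_neqAle eq_sym Y_neq0.
have XY0 : 0 < X `^ (1 - theta) * Y `^ theta by rewrite mulr_gt0 ?powR_gt0.
apply/(seqnorm_le_scale _ t1_gt0 XY0 G0).
have {}hx := (seqnorm_le_scale K t2_gt0 X0 x0).1 hx.
have {}hy := (seqnorm_le_scale K t3_gt0 Y0 y0).1 hy.
pose xi k := x k / X; pose zeta k := y k / Y.
have xi0 k : 0 <= xi k by rewrite divr_ge0 ?(ltW X0).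
have zeta0 k : 0 <= zeta k by rewrite divr_ge0 ?(ltW Y0).
rewrite -/xi -/zeta in hx hy.
have -> : (fun k => x k `^ (1 - theta) * y k `^ theta /
      (X `^ (1 - theta) * Y `^ theta)) =
    (fun k => xi k `^ (1 - theta) * zeta k `^ theta).
  apply/funext => k; rewrite /xi /zeta !powRM ?invr_ge0 ?(ltW X0) ?(ltW Y0)//.
  rewrite -[X^-1]powR_inv1 ?(ltW X0)// -[Y^-1]powR_inv1 ?(ltW Y0)//.
  rewrite -!powRrM !mulN1r !powRN.
  by rewrite invfM; ring.
have le1 (z w : R) : 0 <= z <= 1 -> 0 < w -> z `^ w <= 1.
  move=> /andP[z0 z1] w0; rewrite -[leRHS](congr1 (@^~ w) (@powR1 R)).
  by apply: ge0_ler_powR => //; rewrite ?(ltW w0) ?nnegrE.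
move: hx hy.
case: t1 t2 t3 t1_gt0 t2_gt0 t3_gt0 tE => [r1| |] [r2| |] [r3| |] //=.
- rewrite !lte_fin !powR1 => r1_gt0 r2_gt0 r3_gt0 tE hx hy.
  (* Young's weights, chosen so that the powers of [xi] and [zeta] become [r2] and [r3]; their sum
     is 1 exactly by the relation between the reciprocals. *)
  pose w2 := (1 - theta) * r1 / r2; pose w3 := theta * r1 / r3.
  have w2_gt0 : 0 < w2 by rewrite /w2 !mulr_gt0 ?invr_gt0.
  have w3_gt0 : 0 < w3 by rewrite /w3 !mulr_gt0 ?invr_gt0.
  have w1 : w2 + w3 = 1.
    rewrite -(@divff _ r1) ?gt_eqF// tE /w2 /w3; ring.
  apply: (@le_trans _ _ (\sum_(k < K) (w2 * xi k `^ r2 + w3 * zeta k `^ r3))).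
    apply: ler_sum => k _; rewrite powRM ?powR_ge0// -!powRrM.
    have := @conjugate_powR _ (xi k `^ ((1 - theta) * r1))
      (zeta k `^ (theta * r1)) w2^-1 w3^-1.
    rewrite !invrK !powR_ge0 !invr_gt0 -!powRrM => /(_ isT isT w2_gt0 w3_gt0 w1).
    rewrite (_ : (1 - theta) * r1 / w2 = r2); last first.
      by rewrite /w2; field; rewrite !gt_eqF.
    rewrite (_ : theta * r1 / w3 = r3); last first.
      by rewrite /w3; field; rewrite !gt_eqF.
    by rewrite [w2 * _]mulrC [w3 * _]mulrC.
  rewrite big_split /= -!mulr_sumr -w1.
  by apply: lerD; rewrite -[leRHS]mulr1 ler_wpM2l// ltW.
- rewrite !lte_fin !powR1 mulr0 addr0 => r1_gt0 r2_gt0 _ tE hx hy.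
  apply: le_trans hx; apply: ler_sum => k _.
  rewrite powRM ?powR_ge0// -!powRrM.
  rewrite (_ : (1 - theta) * r1 = r2); last first.
    have -> : r2 = r1^-1 * (r1 * r2) by field; rewrite gt_eqF.
    by rewrite tE; field; rewrite gt_eqF.
  rewrite -[leRHS]mulr1 ler_wpM2l ?powR_ge0// le1 ?mulr_gt0// zeta0/=.
  exact: hy.
- rewrite !lte_fin !powR1 mulr0 add0r => r1_gt0 _ r3_gt0 tE hx hy.
  apply: le_trans hy; apply: ler_sum => k _.
  rewrite powRM ?powR_ge0// -!powRrM.
  rewrite (_ : theta * r1 = r3); last first.
    have -> : r3 = r1^-1 * (r1 * r3) by field; rewrite gt_eqF.
    by rewrite tE; field; rewrite gt_eqF.
  rewrite -[leRHS]mul1r ler_wpM2r ?powR_ge0// le1 ?mulr_gt0// xi0/=.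
  exact: hx.
(* This case and the next three are contradictory: one side of the relation between the reciprocals
   is zero and the other is positive. *)
- rewrite !mulr0 addr0 !lte_fin => r1_gt0 _ _ /eqP.
  by rewrite invr_eq0 gt_eqF.
- rewrite !lte_fin => _ r2_gt0 r3_gt0 /esym/eqP.
  by rewrite gt_eqF// addr_gt0// mulr_gt0// invr_gt0.
- rewrite !lte_fin mulr0 addr0 => _ r2_gt0 _ /esym/eqP.
  by rewrite gt_eqF// mulr_gt0// invr_gt0.
- rewrite !lte_fin mulr0 add0r => _ _ r3_gt0 /esym/eqP.
  by rewrite gt_eqF// mulr_gt0// invr_gt0.
- move=> _ _ _ _ hx hy k kK.
  rewrite -[leRHS]mulr1 ler_pM ?powR_ge0// le1// ?xi0 ?zeta0 /=.
  + exact: hx.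
  + exact: hy.
Qed.

(* [a k] stands for the measure of [{|u| > l0 2^k}]; the exponents are
   [e = 1/q] and [A = alpha/n] *)
Definition levF (l0 e A : R) (a : nat -> R) k :=
  l0 * 2 ^+ k * a k `^ (e - A).
Definition levG (l0 e A : R) (a : nat -> R) k :=
  l0 * 2 ^+ k.+1 * a k.+1 `^ e * a k `^ (- A).

Lemma levG_ge0 l0 e A a k : 0 < l0 -> 0 <= levG l0 e A a k.
Proof. by move=> l00; rewrite !mulr_ge0 ?powR_ge0 ?exprn_ge0 ?(ltW l00). Qed.

Lemma levF_ge0 l0 e A a k : 0 < l0 -> 0 <= levF l0 e A a k.
Proof. by move=> l00; rewrite !mulr_ge0 ?powR_ge0 ?exprn_ge0 ?(ltW l00). Qed.

(** Exponents add up base by base. A level may be zero, where adding exponents is valid as long as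
    their sum is nonzero; the signs of the [e] and [A] guarantee this. *)
Lemma levG_interp (theta l0 e2 e3 A2 A3 : R) (a : nat -> R) k :
  0 < theta < 1 -> 0 < l0 -> 0 < e2 -> 0 < e3 -> 0 < A2 -> 0 < A3 ->
  levG l0 ((1 - theta) * e2 + theta * e3) ((1 - theta) * A2 + theta * A3) a k =
  levG l0 e2 A2 a k `^ (1 - theta) * levG l0 e3 A3 a k `^ theta.
Proof.
move=> /andP[th0 th1] l00 e20 e30 A20 A30.
have th1' : 0 < 1 - theta by rewrite subr_gt0.
have l0k : 0 < l0 * 2 ^+ k.+1 by rewrite mulr_gt0 ?exprn_gt0.
rewrite /levG; move: (l0 * _) l0k => l l_gt0.
rewrite !powRM ?mulr_ge0 ?powR_ge0 ?(ltW l_gt0)// -!powRrM.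
have powRDp (z u v : R) : u + v != 0 -> z `^ (u + v) = z `^ u * z `^ v.
  by move=> uv; rewrite powRD// (negbTE uv).
have lE : l `^ (1 - theta) * l `^ theta = l.
  by rewrite -powRDp ?subrK ?oner_neq0// powRr1// ltW.
rewrite (powRDp (a k.+1)); last by rewrite gt_eqF// addr_gt0// mulr_gt0.
rewrite (_ : - (_ + _) = - A2 * (1 - theta) + - A3 * theta); last by ring.
rewrite (powRDp (a k)); last first.
  by rewrite !mulNr -opprD oppr_eq0 gt_eqF// addr_gt0// mulr_gt0.
rewrite -[X in X * _ * _ = _]lE ![_ * (1 - theta)]mulrC ![_ * theta]mulrC; ring.
Qed.

(* Either the level sets shrink by a definite factor, and then [levF] decays,
   or consecutive level sets are comparable, and then [levG] controls [levF]. *)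
Lemma levF_dichotomy (d e A : R) : 0 < d < 1 -> 0 < A -> A < e ->
  exists2 C : R, 0 < C & forall (l0 : R) (a : nat -> R) k, 0 < l0 ->
    (forall k, 0 <= a k) -> (forall k, a k.+1 <= a k) ->
    levF l0 e A a k.+1 <= d * levF l0 e A a k \/
    levF l0 e A a k.+1 <= C * levG l0 e A a k.
Proof.
move=> /andP[d0 d1] A0 Ae; have eA : 0 < e - A by rewrite subr_gt0.
(* The threshold doubles from [k] to [k.+1], so a shrinking factor [eta] multiplies [levF] by
   [2 * eta ^ (e - A)], which is [d]. *)
pose eta := (d / 2) `^ ((e - A)^-1).
have eta0 : 0 < eta by rewrite powR_gt0 ?divr_gt0.
exists (eta `^ (- A)); first exact: powR_gt0.
move=> l0 a k l00 a0 amono.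
have [le|gt] := leP (a k.+1) (eta * a k); [left|right].
- apply: (@le_trans _ _ (l0 * 2 ^+ k.+1 * (eta * a k) `^ (e - A))).
    apply: ler_wpM2l; first by rewrite mulr_ge0 ?exprn_ge0 ?(ltW l00).
    by apply: ge0_ler_powR => //; rewrite ?nnegrE ?mulr_ge0 ?(ltW eta0) ?(ltW eA).
  rewrite powRM ?(ltW eta0)// /eta -powRrM mulVf ?gt_eqF// powRr1; last first.
    by rewrite ltW// divr_gt0.
  by rewrite /levF exprS le_eqVlt; apply/orP; left; apply/eqP; field.
- have ak1 : 0 < a k.+1 by apply: le_lt_trans gt; rewrite mulr_ge0// ltW.
  have ak : 0 < a k by exact: lt_le_trans (amono k).
  rewrite /levF /levG mulrCA -!mulrA ler_pM2l// ler_pM2l ?exprn_gt0//.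
  rewrite powRB ?gt_eqF//.
  rewrite ler_pM2l ?powR_gt0// mulrC -powRM ?(ltW ak) ?(ltW eta0)//.
  rewrite [_ `^ (- A)]powRN lef_pV2 ?posrE ?powR_gt0 ?mulr_gt0//.
  by apply: ge0_ler_powR; rewrite ?nnegrE ?mulr_ge0 ?(ltW A0)
    ?(ltW eta0) 1?mulrC ?(ltW gt).
Qed.

(* The head term [x 0] is the one that vanishes as [l0] tends to [0]. *)
Definition seqnorm_le_head t N K x : Prop :=
  match t with
  | EFin r => \sum_(k < K.+1) x k `^ r <= 2 * x 0 `^ r + N `^ r
  | _ => forall k, (k <= K)%N -> x k <= Num.max (x 0) N
  end.

(** For infinite [t] the dichotomy is iterated. For finite [t] it is raised to the power [t] and
    summed; the sum of [levF] reappears on the right with factor 1/2 and is absorbed, which doubles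
    the head and the contribution of [levG]. *)
Lemma levF_summation (t : \bar R) (e A : R) : (0%:E < t)%E -> 0 < A -> A < e ->
  exists2 C : R, 0 < C & forall (l0 : R) (a : nat -> R) K N, 0 < l0 ->
    (forall k, 0 <= a k) -> (forall k, a k.+1 <= a k) -> 0 <= N ->
    seqnorm_le t N K (levG l0 e A a) ->
    seqnorm_le_head t (C * N) K (levF l0 e A a).
Proof.
case: t => [r| |] //= t0 A0 Ae; last first.
  have d01 : 0 < (2^-1 : R) < 1 by lra.
  have [C C0 CP] := levF_dichotomy d01 A0 Ae.
  exists C => // l0 a K N l00 a0 amono N0 hG; elim=> [_|k IH kK].
    by rewrite le_max lexx.
  have [le|le] := CP l0 a k l00 a0 amono.
    apply: le_trans (IH (ltnW kK)); apply: (le_trans le).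
    by rewrite ler_piMl ?levF_ge0// invf_le1 ?ler1n.
  rewrite le_max; apply/orP; right; apply: (le_trans le).
  by rewrite ler_pM2l// hG.
rewrite lte_fin in t0.
(* The decay factor whose [r]-th power is the 1/2 needed for absorption. *)
pose d : R := 2^-1 `^ r^-1.
have dge : 0 <= d by exact: powR_ge0.
have dr : d `^ r = 2^-1 by rewrite /d -powRrM mulVf ?gt_eqF// powRr1.
have d01 : 0 < d < 1.
  rewrite powR_gt0//= /d -[ltRHS](congr1 (@^~ r^-1) (@powR1 R)).
  rewrite gt0_ltr_powR ?invr_gt0 ?nnegrE//.
  by rewrite invf_lt1 ?ltr1n.
have [C C0 CP] := levF_dichotomy d01 A0 Ae.
exists (2 `^ r^-1 * C); first by rewrite mulr_gt0// powR_gt0.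
move=> l0 a K N l00 a0 amono N0 hG.
have F0 k : 0 <= levF l0 e A a k by exact: levF_ge0.
have G0 k : 0 <= levG l0 e A a k by exact: levG_ge0.
have rec k : levF l0 e A a k.+1 `^ r <=
    2^-1 * levF l0 e A a k `^ r + C `^ r * levG l0 e A a k `^ r.
  have [le|le] := CP l0 a k l00 a0 amono.
    apply: (@le_trans _ _ ((d * levF l0 e A a k) `^ r)).
      by apply: ge0_ler_powR; rewrite ?nnegrE ?(ltW t0) ?F0 ?(mulr_ge0 dge).
    by rewrite powRM// dr lerDl (mulr_ge0 (powR_ge0 _ _) (powR_ge0 _ _)).
  apply: (@le_trans _ _ ((C * levG l0 e A a k) `^ r)).
    by apply: ge0_ler_powR; rewrite ?nnegrE ?(ltW t0) ?F0 ?(mulr_ge0 (ltW C0)).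
  rewrite powRM ?(ltW C0)// lerDr.
  by rewrite (mulr_ge0 _ (powR_ge0 _ _))// invr_ge0.
have NE : (2 `^ r^-1 * C * N) `^ r = 2 * (C `^ r * N `^ r).
  rewrite -mulrA powRM ?powR_ge0 ?mulr_ge0 ?(ltW C0)// -powRrM mulVf ?gt_eqF//.
  by rewrite powRr1// powRM ?(ltW C0).
rewrite NE.
set S := \sum_(k < K.+1) _.
have S1 : S = levF l0 e A a 0 `^ r + \sum_(k < K) levF l0 e A a k.+1 `^ r.
  by rewrite /S big_ord_recl.
have S2 : \sum_(k < K) levF l0 e A a k `^ r <= S.
  by rewrite /S big_ord_recr /= lerDl powR_ge0.
have S3 : \sum_(k < K) levF l0 e A a k.+1 `^ r <=
   2^-1 * \sum_(k < K) levF l0 e A a k `^ r + C `^ r * N `^ r.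
  apply: (@le_trans _ _ (2^-1 * \sum_(k < K) levF l0 e A a k `^ r
      + C `^ r * \sum_(k < K) levG l0 e A a k `^ r)).
    by rewrite !mulr_sumr -big_split /=; apply: ler_sum => k _; exact: rec.
  by rewrite lerD2l ler_wpM2l ?powR_ge0.
move: S1 S2 S3; clear; move: (levF _ _ _ _ _ `^ r) => f.
lra.
Qed.

End Sequences.

(** * The Lebesgue outer measure of boxes, and sections of sets in a product *)

Section BoxMeasure.
Context {R : realType}.
Local Open Scope ereal_scope.

Lemma boxvol_ge0 n (a b : 'rV[R]_n) : (0 <= boxvol a b)%R.
Proof. by apply: prodr_ge0 => i _; rewrite le_max lexx orbT. Qed.

Lemma lebo_le_boxvol n (a b : 'rV[R]_n) : lebo (box a b) <= (boxvol a b)%:E.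
Proof.
have le1 : boxmu (box a b) <= (boxvol a b)%:E.
  by apply: ereal_inf_lbound; left; exists (a, b).
apply: le_trans le1; rewrite Defs.lebo.unlock; apply: ereal_inf_lbound.
exists (fun k => if k == 0%N then box a b : set (RnD R n) else set0).
  by split=> [//|x xab]; exists 0%N.
rewrite (nneseries_split 0%N 1%N) ?add0n; last first.
  by move=> k _; exact: boxmu_ge0.
rewrite big_mkord big_ord1 eseries0 ?adde0// => -[//|i] _ _.
exact: boxmu0.
Qed.

(* Dimension at least one: the empty pieces of a cover are replaced by boxes of
   volume zero, whereas every box of R^0 has volume one. *)
Lemma lebo_box_cover n (A : set 'rV[R]_n.+1) (e : R) : (0 < e)%R ->
  lebo A < +oo ->
  exists c : nat -> 'rV[R]_n.+1 * 'rV[R]_n.+1,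
    A `<=` \bigcup_k box (c k).1 (c k).2 /\
    \sum_(k <oo) (boxvol (c k).1 (c k).2)%:E <= lebo A + e%:E.
Proof.
move=> e0 Aoo.
have Af : lebo A \is a fin_num by rewrite ge0_fin_numE ?lebo_ge0.
have e2 : (0 < e / 2)%R by rewrite divr_gt0.
have [F [_ AF] FA] : exists2 F, measurable_cover (A : set (RnD R n.+1)) F &
    \sum_(k <oo) boxmu (F k) < lebo A + (e / 2)%:E.
  move: Af; rewrite Defs.lebo.unlock => /(lb_ereal_inf_adherent e2)[_ [F FA <-]].
  by exists F.
have Ffin k : boxmu (F k) < +oo.
  rewrite ltey; apply/negP => /eqP Fk; move: FA.
  rewrite (@eseries_pinfty _ (fun k => boxmu (F k)) _ k)//.
    by rewrite ltNge leey.
  by move=> i _; rewrite gt_eqF// (lt_le_trans _ (boxmu_ge0 _)).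
have pick k : {c : 'rV[R]_n.+1 * 'rV[R]_n.+1 | F k `<=` box c.1 c.2 /\
   (boxvol c.1 c.2)%:E <= boxmu (F k) + ((e / 2) / (2 ^ k.+1)%:R)%:E}.
  apply: cid; have ek : (0 < (e / 2) / (2 ^ k.+1)%:R)%R.
    by rewrite divr_gt0// ltr0n expn_gt0.
  have : boxmu (F k) \is a fin_num by rewrite ge0_fin_numE ?boxmu_ge0.
  move=> /(lb_ereal_inf_adherent ek)[_ [[c Fc <-]|[u F0 <-]]] le.
    by exists c; split => //; exact: ltW.
  exists (const_mx 1%R, 0%R); split; first by rewrite [F k]F0.
  have -> : boxvol (const_mx 1%R : 'rV[R]_n.+1) 0%R = 0%R.
    rewrite /boxvol big_ord_recl !mxE sub0r.
    by rewrite (max_idPr _) ?mul0r// oppr_le0.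
  by rewrite adde_ge0// ?boxmu_ge0// lee_fin ltW.
pose c k := sval (pick k); exists c; split.
  by move=> x /AF[k _ Fx]; exists k => //; exact: (svalP (pick k)).1.
rewrite [e in leRHS]splitr EFinD addeA.
apply: le_trans (leeD (ltW FA) (lexx _)).
apply: le_trans (epsilon_trick xpredT (fun k => boxmu_ge0 (F k)) (ltW e2)).
by apply: lee_nneseries => k _; rewrite ?lee_fin ?boxvol_ge0//;
  case: (svalP (pick k)).
Qed.

(** Caratheodory's criterion: cutting each box of a nearly optimal cover at height [c] in direction
    [i] gives two boxes whose volumes add up to the original one. Placing [H] between the open and
    the closed half-space treats both at once. *)
Lemma halfspace_measurable n (i : 'I_n.+1) (c : R) (H : set 'rV[R]_n.+1) :
  [set x : 'rV[R]_n.+1 | (x 0 i < c)%R] `<=` H ->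
  H `<=` [set x : 'rV[R]_n.+1 | (x 0 i <= c)%R] ->
  measurable (H : set (Leb R n.+1)).
Proof.
move=> cH Hc; apply: le_caratheodory_measurable => X /=.
have [->|] := eqVneq (lebo X) +oo; first by rewrite leey.
rewrite -ltey => Xoo; apply/lee_addgt0Pr => e e0.
have [d [Xd dX]] := lebo_box_cover e0 Xoo.
apply: le_trans dX.
pose upd (x : 'rV[R]_n.+1) (t : R) : 'rV[R]_n.+1 :=
  \row_j (if j == i then t else x 0%R j).
pose bl k := upd (d k).2 (Num.min ((d k).2 0%R i) c).
pose ar k := upd (d k).1 (Num.max ((d k).1 0%R i) c).
have -> : \sum_(k <oo) (boxvol (d k).1 (d k).2)%:E =
   \sum_(k <oo) (boxvol (d k).1 (bl k))%:E +
   \sum_(k <oo) (boxvol (ar k) (d k).2)%:E.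
  rewrite -nneseriesD; [|by move=> *; rewrite lee_fin boxvol_ge0..].
  apply: eq_eseriesr => k _; rewrite -EFinD; congr _%:E.
  have volE (a b : 'rV[R]_n.+1) : boxvol a b = (Num.max (b 0 i - a 0 i) 0 *
      \prod_(j | j != i) Num.max (b 0 j - a 0 j) 0)%R.
    by rewrite /boxvol (bigD1 i).
  rewrite !volE !mxE eqxx.
  under [X in (_ = _ * X + _)%R]eq_bigr => j ji do rewrite !mxE (negbTE ji).
  under [X in (_ = _ + _ * X)%R]eq_bigr => j ji do rewrite !mxE (negbTE ji).
  rewrite -mulrDl; congr (_ * _)%R.
  move: ((d k).2 0%R i) ((d k).1 0%R i) => u v.
  rewrite /Num.min /Num.max.
  by do ![case: ifPn => //]; lra.
apply: leeD.
- apply: (@le_trans _ _ (lebo (\bigcup_k box (d k).1 (bl k)))).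
    apply: le_lebo => x [/Xd[k _ xk] /Hc xc]; exists k => // j.
    rewrite !mxE; case: eqP => [->|_]; last exact: xk.
    by case/andP: (xk i) => -> /= xi; rewrite le_min xi.
  apply: le_trans (lebo_sigma_subadditive _) _.
  by apply: lee_nneseries => k _; rewrite ?lebo_ge0 ?lebo_le_boxvol.
- apply: (@le_trans _ _ (lebo (\bigcup_k box (ar k) (d k).2))).
    apply: le_lebo => x [/Xd[k _ xk] xH]; exists k => // j.
    rewrite !mxE; case: eqP => [->|_]; last exact: xk.
    have cx : (c <= x 0 i)%R by rewrite leNgt; apply/negP => /cH.
    by case/andP: (xk i) => xi -> /=; rewrite ge_max xi cx.
  apply: le_trans (lebo_sigma_subadditive _) _.
  by apply: lee_nneseries => k _; rewrite ?lebo_ge0 ?lebo_le_boxvol.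
Qed.

Lemma box_measurable n (a b : 'rV[R]_n.+1) :
  measurable (box a b : set (Leb R n.+1)).
Proof.
have -> : (box a b : set (Leb R n.+1)) = \bigcap_(i in [set: 'I_n.+1])
    ((~` [set x : Leb R n.+1 | (x 0 i < a 0 i)%R]) `&`
     [set x : Leb R n.+1 | (x 0 i <= b 0 i)%R]).
  apply/seteqP; split=> x.
    move=> xab i _; case/andP: (xab i) => ai bi; split => //=.
    by apply/negP; rewrite -leNgt.
  by move=> xab i; case: (xab i I) => /negP/=; rewrite -leNgt => -> ->.
apply: fin_bigcap_measurable => [//|i _]; apply: measurableI.
  apply: measurableC; apply: (@halfspace_measurable n i (a 0%R i)
    [set x : 'rV[R]_n.+1 | (x 0 i < a 0 i)%R]) => // x /=.
  exact: ltW.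
apply: (@halfspace_measurable n i (b 0%R i)
  [set x : 'rV[R]_n.+1 | (x 0 i <= b 0 i)%R]) => // x /=; exact: ltW.
Qed.

(* Tonelli for outer measures, in the direction that needs no measurability *)
Lemma lebo_sections m n (S : set 'rV[R]_(m.+1 + n.+1)) (A : set 'rV[R]_m.+1)
  (h : R) : (0 <= h)%R ->
  (forall x, A x -> h%:E <= lebo [set y | S (row_mx x y)]) ->
  h%:E * lebo A <= lebo S.
Proof.
rewrite le_eqVlt => /predU1P[<- _|h0 hA]; first by rewrite mul0e lebo_ge0.
have [->|] := eqVneq (lebo S) +oo; first by rewrite leey.
rewrite -ltey => Soo; apply/lee_addgt0Pr => e e0.
have [d [Sd dS]] : exists d : nat -> 'rV[R]_(m.+1 + n.+1) * 'rV[R]_(m.+1 + n.+1),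
    S `<=` \bigcup_k box (d k).1 (d k).2 /\
    \sum_(k <oo) (boxvol (d k).1 (d k).2)%:E <= lebo S + e%:E.
  exact: (@lebo_box_cover (m + n.+1) S e e0 Soo).
apply: le_trans dS.
(* Each covering box is the product of [P k] with a box of volume [w k]. Thus [g x] bounds the outer
   measure of the section of [S] over [x], while the integral of [g] is at most the total volume of
   the cover. *)
pose P k : set (Leb R m.+1) := box (lsubmx (d k).1) (lsubmx (d k).2).
pose w k := boxvol (rsubmx (d k).1) (rsubmx (d k).2).
pose f k (x : Leb R m.+1) := (w k)%:E * (\1_(P k) x)%:E.
pose g x := \sum_(k <oo) f k x.
have f0 k x : 0 <= f k x by rewrite mule_ge0// lee_fin ?boxvol_ge0.
have mP k : measurable (P k) by exact: box_measurable.
have mf k : measurable_fun setT (f k).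
  apply: measurable_funeM; apply/measurable_EFinP.
  exact: measurable_indic.
have mg : measurable_fun setT g.
  by apply: ge0_emeasurable_sum => // k x _ _; exact: f0.
have g0 x : 0 <= g x by exact: nneseries_ge0.
apply: (@le_trans _ _ (\int[leb R m.+1]_x g x)); last first.
  rewrite integral_nneseries//; apply: lee_nneseries => k _.
    by move=> _; apply: integral_ge0.
  rewrite ge0_integralZl//; last 2 first.
  - by apply/measurable_EFinP; exact: measurable_indic.
  - by rewrite lee_fin boxvol_ge0.
  rewrite integral_indic// setIT /boxvol big_split_ord EFinM muleC.
  apply: lee_pmul; rewrite ?lebo_ge0 ?lee_fin ?boxvol_ge0//.
    apply: le_trans (lebo_le_boxvol _ _) _; rewrite lee_fin /boxvol.
    by rewrite le_eqVlt; apply/orP; left; apply/eqP/eq_bigr => i _; rewrite !mxE.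
  by rewrite le_eqVlt; apply/orP; left; apply/eqP/eq_bigr => i _; rewrite !mxE.
(* Markov's inequality for [g], whose superlevel set at [h] contains [A]. *)
apply: (@le_trans _ _ (h%:E * leb R m.+1 [set x | h%:E <= `|g x|])).
  apply: lee_wpmul2l; first by rewrite lee_fin ltW.
  apply: le_lebo => x Ax /=; rewrite gee0_abs//.
  apply: (le_trans (hA x Ax)).
  pose Q k := if x \in P k then box (rsubmx (d k).1) (rsubmx (d k).2) else set0.
  apply: (@le_trans _ _ (lebo (\bigcup_k Q k))).
    apply: le_lebo => y /= /Sd[k _ xyk]; exists k => //.
    have xP : P k x.
      by move=> i; have := xyk (lshift _ i); rewrite row_mxEl !mxE.
    rewrite /Q mem_set// => i.
    by have := xyk (rshift _ i); rewrite row_mxEr !mxE.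
  apply: le_trans (lebo_sigma_subadditive _) _.
  apply: lee_nneseries => k _; first by rewrite lebo_ge0.
  rewrite /Q /f indicE; case: ifPn => _; last by rewrite lebo0 mule0.
  by rewrite mule1; exact: lebo_le_boxvol.
have := @le_integral_abse _ _ _ (leb R m.+1) setT measurableT g h mg h0.
by rewrite setTI; under eq_integral do rewrite gee0_abs//.
Qed.

(** One-dimensional boxes are closed intervals, so countable subadditivity of [lebesgue_measure]
    bounds the length by the total length of any cover. *)
Lemma boxvol_le_lebo1 (a b : 'rV[R]_1) : (boxvol a b)%:E <= lebo (box a b).
Proof.
have [->|] := eqVneq (lebo (box a b)) +oo; first by rewrite leey.
rewrite -ltey => Soo; apply/lee_addgt0Pr => e e0.
have [d [Sd dS]] := lebo_box_cover e0 Soo.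
apply: le_trans dS.
have vol1 (u v : 'rV[R]_1) : (boxvol u v)%:E =
    lebesgue_measure `[u ord0 ord0, v ord0 ord0]%classic.
  rewrite lebesgue_measure_itv /= lte_fin /boxvol big_ord1 -EFinB.
  case: ltP => uv; first by rewrite (max_idPl _)// subr_ge0 ltW.
  by rewrite (max_idPr _)// subr_le0.
rewrite vol1 (eq_eseriesr (fun k _ => vol1 (d k).1 (d k).2)).
apply: measure_sigma_subadditive => // t /=.
rewrite in_itv /= => abt.
have /Sd[k _ dk] : box a b (const_mx t) by move=> i; rewrite mxE ord1.
exists k => //=; rewrite in_itv /=.
by have := dk ord0; rewrite mxE.
Qed.

(** Induction on the dimension: over each point of the first side, the section contains the box of
    the remaining coordinates, and [lebo_sections] multiplies the two bounds. *)
Lemma boxvol_le_lebo n (a b : 'rV[R]_n.+1) : (boxvol a b)%:E <= lebo (box a b).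
Proof.
elim: n a b => [|n IH] a b; first exact: boxvol_le_lebo1.
pose a1 : 'rV[R]_1 := lsubmx (a : 'rV[R]_(1 + n.+1)).
pose b1 : 'rV[R]_1 := lsubmx (b : 'rV[R]_(1 + n.+1)).
pose a2 := rsubmx (a : 'rV[R]_(1 + n.+1)).
pose b2 := rsubmx (b : 'rV[R]_(1 + n.+1)).
have -> : boxvol a b = (boxvol a2 b2 * boxvol a1 b1)%R.
  rewrite mulrC /boxvol [LHS](@big_split_ord _ _ _ 1 n.+1).
  by congr (_ * _)%R; apply: eq_bigr => i _; rewrite !mxE.
rewrite EFinM; apply: (@le_trans _ _ ((boxvol a2 b2)%:E * lebo (box a1 b1))).
  by apply: lee_wpmul2l; [rewrite lee_fin boxvol_ge0|exact: boxvol_le_lebo1].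
apply: (@lebo_sections 0 n) => [|x xab]; first exact: boxvol_ge0.
apply: (le_trans (IH _ _)); apply: le_lebo => y yab i /=.
case: (@fintype.splitP 1 n.+1 i) => j ij.
  have -> : i = @lshift 1 n.+1 j by exact: val_inj.
  by have := xab j; rewrite !mxE (@unsplitK 1 n.+1 (inl j)).
have -> : i = @rshift 1 n.+1 j by exact: val_inj.
by have := yab j; rewrite !mxE (@unsplitK 1 n.+1 (inr j)).
Qed.

End BoxMeasure.

(** * Distribution functions and the difference quotient *)

Section LorentzLevels.
Context {R : realType}.
Local Open Scope ereal_scope.

Lemma distrib_ge0 n (f : 'rV[R]_n -> \bar R) b : 0 <= distrib f b.
Proof. exact: lebo_ge0. Qed.

Lemma le_distrib n (f : 'rV[R]_n -> \bar R) b c : (b <= c)%R ->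
  distrib f c <= distrib f b.
Proof.
by move=> bc; apply: le_lebo => x /=; apply: le_lt_trans; rewrite lee_fin.
Qed.

(** By monotonicity the superlevel sets of [distrib f] are intervals. *)
Lemma measurable_distrib n (f : 'rV[R]_n -> \bar R) :
  measurable_fun setT (distrib f).
Proof.
apply: (measurability _ (ErealGenOInfty.measurableE R)).
move=> _ [_ [x ->] <-]; rewrite setTI; apply: is_interval_measurable.
move=> b c _ /=; rewrite !in_itv/= !andbT => cx t /andP[_ tc].
by rewrite in_itv/= andbT; exact: lt_le_trans cx (le_distrib _ tc).
Qed.

Definition lorentz_integrand n (s r : R) (f : 'rV[R]_n -> \bar R) (b : R) :=
  poweR (b%:E * poweR (distrib f b) s^-1) r * (b^-1)%:E.

Lemma lorentz_integrand_ge0 n s r (f : 'rV[R]_n -> \bar R) b : (0 < b)%R ->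
  0 <= lorentz_integrand s r f b.
Proof. by move=> b0; rewrite mule_ge0 ?poweR_ge0// lee_fin invr_ge0 ltW. Qed.

Lemma measurable_lorentz_integrand n s r (f : 'rV[R]_n -> \bar R) :
  measurable_fun (`]0%R, +oo[%classic : set R) (lorentz_integrand s r f).
Proof.
apply: (eq_measurable_fun (fun b : R =>
    poweR (b%:E * poweR (distrib f b) s^-1) r * (b `^ (-1))%:E)).
  by move=> b; rewrite inE/= in_itv/= andbT => b0; rewrite powR_inv1// ltW.
apply: measurable_funTS; apply: emeasurable_funM; last first.
  by apply/measurable_EFinP; exact: measurable_powR.
apply: (measurableT_comp (measurable_poweR _)) => //.
apply: emeasurable_funM; first exact/measurable_EFinP.
exact: (measurableT_comp (measurable_poweR _) (measurable_distrib f)).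
Qed.

Lemma enorm_le n (x : 'rV[R]_n) (rho : R) : (0 <= rho)%R ->
  (forall i, `|x ord0 i| <= rho)%R ->
  (enorm x <= Num.sqrt n%:R * rho)%R.
Proof.
move=> rho0 xr; rewrite -[rho in leRHS]ger0_norm// -sqrtr_sqr -sqrtrM ?ler0n//.
apply: ler_wsqrtr; rewrite mulr_natl -[n in leRHS]card_ord -sumr_const.
by apply: ler_sum => i _; rewrite -real_normK ?num_real// ler_sqr ?nnegrE.
Qed.

Lemma enorm_gt0 n (x : 'rV[R]_n) : x != 0%R -> (0 < enorm x)%R.
Proof.
move=> x0; rewrite /enorm sqrtr_gt0 lt_neqAle sumr_ge0 ?andbT; last first.
  by move=> i _; exact: sqr_ge0.
apply: contra x0 => /eqP/esym/eqP; rewrite psumr_eq0; last first.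
  by move=> i _; exact: sqr_ge0.
move=> /allP h; apply/eqP/rowP => i; rewrite mxE.
by apply/eqP; rewrite -sqrf_eq0; apply: h; rewrite mem_index_enum.
Qed.

(** For [e = n / s + beta] its Lorentz norm is [gag_seminorm]. *)
Definition quotient n (e : R) (u : 'rV[R]_n -> \bar R) :=
  pairfun (fun x y => `|u x - u y| * ((powR (enorm (x - y)) e)^-1)%:E).

(* If [|u x| > l1], the cube of measure [2 a] centred at [x] contains points [y]
   with [|u y| <= l0] of measure at least [a]. *)
Lemma distrib_quotient n (u : 'rV[R]_n.+1 -> \bar R) (e l0 l1 a : R) :
  (0 <= e)%R -> (l0 < l1)%R -> (0 < a)%R -> distrib u l0 = a%:E ->
  a%:E * distrib u l1 <= distrib (quotient e u) ((l1 - l0) *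
    (Num.sqrt n.+1%:R * ((2 * a) `^ (n.+1%:R^-1) / 2)) `^ (- e))%R.
Proof.
move=> e0 l01 a0 ua.
(* Half the side of a cube of measure [2 * a]; the Euclidean distance from its centre to any of its
   points is at most [sqrt n.+1 * rho]. *)
set rho := ((2 * a) `^ _ / 2)%R.
have a2 : (0 < 2 * a)%R by rewrite mulr_gt0.
have rho0 : (0 < rho)%R by rewrite divr_gt0// powR_gt0.
apply: (@lebo_sections R n n); first exact: ltW.
move=> x /= xl1; set S := [set y | _].
pose Q := box (x - const_mx rho)%R (x + const_mx rho)%R.
have Qvol : boxvol (x - const_mx rho)%R (x + const_mx rho)%R = (2 * a)%R.
  rewrite /boxvol (eq_bigr (fun=> 2 * rho)%R); last first.
    move=> i _; rewrite !mxE (_ : (_ - _)%R = 2 * rho)%R; last by ring.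
    by rewrite (max_idPl _)// mulr_ge0// ltW.
  rewrite prodr_const card_ord /rho mulrC divfK// -powR_mulrn ?powR_ge0//.
  by rewrite -powRrM mulVf// powRr1// ltW.
(* Points of the cube with [|u y| > l0] have measure at most [a]; all others lie in [S]. *)
have QS : lebo Q <= lebo S + a%:E.
  rewrite -ua; apply: le_trans (outer_measureU2 lebo _ _).
  apply: le_lebo => y Qy /=; have [yl0|] := ltP l0%:E `|u y|; first by right.
  move=> yl0; left; rewrite /S /quotient /pairfun /= row_mxKl row_mxKr.
  have xy : x != y.
    apply/eqP => xy; have l01E : l0%:E < l1%:E by rewrite lte_fin.
    by have := le_lt_trans yl0 (lt_trans l01E xl1); rewrite xy ltxx.
  have nxy : (0 < enorm (x - y))%R by rewrite enorm_gt0// subr_eq0.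
  have nle : (enorm (x - y) <= Num.sqrt n.+1%:R * rho)%R.
    apply: enorm_le => [|i]; first exact: ltW.
    have := Qy i; rewrite !mxE ler_norml => /andP[h1 h2].
    by apply/andP; split; lra.
  have ple : ((Num.sqrt n.+1%:R * rho) `^ (- e) <= (enorm (x - y) `^ e)^-1)%R.
    have srho : (0 < Num.sqrt n.+1%:R * rho)%R.
      by rewrite (mulr_gt0 _ rho0)// sqrtr_gt0.
    rewrite powRN lef_pV2 ?posrE ?(powR_gt0 _ nxy) ?(powR_gt0 _ srho)//.
    by apply: ge0_ler_powR; rewrite ?nnegrE ?(ltW srho) ?(ltW nxy).
  have pgt : (0 < (enorm (x - y) `^ e)^-1)%R by rewrite invr_gt0 powR_gt0.
  move: pgt ple; move: (_ ^-1)%R ((_ * rho) `^ _)%R => c c' cgt c'c.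
  have uyf : u y \is a fin_num.
    by rewrite fin_num_abs (le_lt_trans yl0)// ltry.
  move: xl1 yl0; rewrite -(fineK uyf); move: (fine _) => v.
  rewrite abseM abse_id [`|c%:E|]gee0_abs ?lee_fin ?(ltW cgt)//.
  case: (u x) => [w| |] /=; last 2 first.
  - by rewrite gt0_mulye ?lte_fin ?ltry.
  - by rewrite gt0_mulye ?lte_fin ?ltry.
  rewrite -EFinM !lte_fin => wl1 vl0.
  apply: (@le_lt_trans _ _ ((l1 - l0) * c)%R).
    by rewrite ler_wpM2l// subr_ge0 ltW.
  rewrite ltr_pM2r//; apply: lt_le_trans (lerB_dist _ _); lra.
have := le_trans (boxvol_le_lebo _ _) QS; rewrite Qvol.
have : 0 <= lebo S by exact: lebo_ge0.
case: (lebo S) => [L| |] //= L0; last by move=> _; rewrite leey.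
by rewrite -EFinD !lee_fin; lra.
Qed.

End LorentzLevels.

(** * Splitting integrals over the half-line *)

Section Pieces.
Context {R : realType}.
Local Open Scope ereal_scope.
Variable h : R -> \bar R.
Hypothesis mh : measurable_fun (`]0%R, +oo[%classic : set R) h.
Hypothesis h0 : forall x, (0 < x)%R -> 0 <= h x.

Local Notation mu := (@lebesgue_measure R).

Let mhs (D : set R) : measurable D -> D `<=` `]0%R, +oo[%classic ->
  measurable_fun D h.
Proof. by move=> mD DD; apply: measurable_funS mh. Qed.

Let sub_pos (x : R) b : (0 < x)%R ->
  [set` Interval (BLeft x) b] `<=` (`]0%R, +oo[%classic : set R).
Proof.
move=> x0 y /=; rewrite !in_itv/= => /andP[xy _].
by rewrite andbT (lt_le_trans x0).
Qed.

Lemma integral_ge_piece (x y m : R) : (0 < x)%R -> (x <= y)%R -> (0 <= m)%R ->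
  (forall z, (x <= z < y)%R -> m%:E <= h z) ->
  (m * (y - x))%:E <= \int[mu]_(z in `[x, y[) h z.
Proof.
move=> x0 xy m0 mz.
have -> : (m * (y - x))%:E = \int[mu]_(z in `[x, y[) m%:E.
  rewrite integral_cst//= lebesgue_measure_itv/= lte_fin.
  case: ltP => [_|yx]; first by rewrite -EFinB -EFinM.
  by rewrite (@le_anti _ _ x y) ?xy// subrr mulr0 mule0.
apply: ge0_le_integral => //.
- by apply: mhs => //; exact: sub_pos.
Qed.

Lemma integral_le_piece (x y m : R) : (0 < x)%R -> (x <= y)%R ->
  (forall z, (x <= z < y)%R -> h z <= m%:E) ->
  \int[mu]_(z in `[x, y[) h z <= (m * (y - x))%:E.
Proof.
move=> x0 xy mz.
have -> : (m * (y - x))%:E = \int[mu]_(z in `[x, y[) m%:E.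
  rewrite integral_cst//= lebesgue_measure_itv/= lte_fin.
  case: ltP => [_|yx]; first by rewrite -EFinB -EFinM.
  by rewrite (@le_anti _ _ x y) ?xy// subrr mulr0 mule0.
apply: ge0_le_integral => //.
- move=> z /=; rewrite in_itv/= => /andP[xz _]; apply: h0.
  exact: lt_le_trans xz.
- by apply: mhs => //; exact: sub_pos.
Qed.

Lemma integral_concat (a : itv_bound R) (x y : R) :
  [set` Interval a (BLeft y)] `<=` (`]0%R, +oo[%classic : set R) ->
  (a <= BLeft x)%O -> (x <= y)%R ->
  \int[mu]_(z in [set` Interval a (BLeft y)]) h z =
  \int[mu]_(z in [set` Interval a (BLeft x)]) h z + \int[mu]_(z in `[x, y[) h z.
Proof.
move=> sub ax xy.
move: sub; rewrite (@itv_bndbnd_setU _ _ a (BLeft x) (BLeft y))// => sub.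
rewrite ge0_integral_setU//.
- by apply: mhs => //; exact: measurableU.
- by move=> z /sub /=; rewrite in_itv/= andbT; exact: h0.
- rewrite disj_set2E; apply/eqP/seteqP; split => z //= -[].
  rewrite !in_itv/= => /andP[_ zx] /andP[xz _].
  by move: (lt_le_trans zx xz); rewrite ltxx.
Qed.

(** Since [b] at least doubles, the intervals from [b k / 2] to [b k] are disjoint. *)
Lemma sum_le_integral (b : nat -> R) (d : nat -> \bar R) K :
  (forall k, (k <= K)%N -> (0 < b k)%R) ->
  (forall k, (k < K)%N -> (2 * b k <= b k.+1)%R) ->
  (forall k, (k <= K)%N -> d k <= \int[mu]_(z in `[(b k / 2)%R, b k[) h z) ->
  \sum_(k < K.+1) d k <= \int[mu]_(z in `]0%R, +oo[) h z.
Proof.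
move=> b0 bS db.
(* Stopping at [b K] leaves room for the next interval in the induction. *)
apply: (@le_trans _ _ (\int[mu]_(z in `]0%R, b K[) h z)); last first.
  apply: ge0_subset_integral => //.
    by move=> z /=; rewrite in_itv/= andbT; exact: h0.
  by move=> z /=; rewrite !in_itv/= andbT => /andP[].
have sub c : (`]0%R, c[%classic : set R) `<=` `]0%R, +oo[%classic.
  by move=> z /=; rewrite !in_itv/= andbT => /andP[].
elim: K b0 bS db => [|K IH] b0 bS db.
  rewrite big_ord1; apply: (le_trans (db 0%N _)) => //.
  have bb : (0 < b 0%N)%R by exact: b0.
  apply: ge0_subset_integral => //.
  - by apply: mhs.
  - by move=> z /sub /=; rewrite in_itv/= andbT; exact: h0.
  - move=> z /=; rewrite !in_itv/= => /andP[h1 ->]; rewrite andbT.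
    by apply: lt_le_trans h1; rewrite divr_gt0.
have b1 : (0 < b K.+1)%R by exact: b0.
rewrite big_ord_recr /= (@integral_concat _ (b K.+1 / 2)%R)//; last 2 first.
- by rewrite bnd_simp; lra.
- by lra.
apply: leeD; last exact: db.
apply: (@le_trans _ _ (\int[mu]_(z in `]0%R, b K[) h z)).
  apply: IH => [k kK|k kK|k kK]; first by apply: b0; rewrite (leq_trans kK).
    by apply: bS; rewrite (leq_trans kK).
  by apply: db; rewrite (leq_trans kK).
apply: ge0_subset_integral => //.
- by apply: mhs.
- by move=> z /sub /=; rewrite in_itv/= andbT; exact: h0.
- move=> z /=; rewrite !in_itv/= => /andP[-> h1]/=.
  by apply: lt_le_trans h1 _; have := bS K (ltnSn _); lra.
Qed.

Lemma integral_le_sum (l0 : R) (d : nat -> \bar R) K : (0 < l0)%R ->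
  (forall k, (k < K)%N ->
    \int[mu]_(z in `[(l0 * 2 ^+ k)%R, (l0 * 2 ^+ k.+1)%R[) h z <= d k) ->
  \int[mu]_(z in `[l0, (l0 * 2 ^+ K)%R[) h z <= \sum_(k < K) d k.
Proof.
move=> l00; elim: K => [|K IH] hd.
  by rewrite expr0 mulr1 set_itvco0 integral_set0 big_ord0.
have p1 k : (1 <= 2 ^+ k :> R)%R by rewrite exprn_ege1// ler1n.
rewrite (@integral_concat _ (l0 * 2 ^+ K)%R); last 3 first.
- exact: sub_pos.
- by rewrite bnd_simp ler_peMr// ltW.
- by rewrite ler_pM2l// exprS ler_peMl ?exprn_ge0// ler1n.
rewrite big_ord_recr /=; apply: leeD; last exact: hd.
by apply: IH => k kK; apply: hd; rewrite (leq_trans kK).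
Qed.

(** Monotone convergence along intervals exhausting the half-line, with an error [g] that disappears
    in the limit. *)
Lemma integral_dyadic_le (g : nat -> R) (D : R) :
  g @ \oo --> (0%R : R) ->
  (forall m, \int[mu]_(z in `[((2 ^+ m)^-1)%R, (2 ^+ m)%R[) h z <= (D + g m)%:E) ->
  \int[mu]_(z in `]0%R, +oo[) h z <= D%:E.
Proof.
move=> g0 hD.
pose F (m : nat) := `[((2 ^+ m)^-1)%R, (2 ^+ m)%R[%classic : set R.
have p0 m : (0 < (2 ^+ m)^-1 :> R)%R by rewrite invr_gt0 exprn_gt0.
have FE : `]0%R, +oo[%classic = \bigcup_m F m.
  apply/seteqP; split => z /=; last first.
    move=> [m _]; rewrite /F /= !in_itv/= andbT => /andP[+ _].
    exact: lt_le_trans.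
  rewrite in_itv/= andbT => z0.
  have two_gt (w : R) : exists m : nat, forall k, (m <= k)%N -> (w < 2 ^+ k)%R.
    exists (Num.bound `|w|%R) => k mk; apply: le_lt_trans (ler_norm _) _.
    apply: (lt_le_trans (archi_boundP (normr_ge0 w))).
    by rewrite -natrX ler_nat (leq_trans mk)// ltnW// ltn_expl.
  have [m1 hm1] := two_gt z; have [m2 hm2] := two_gt (z^-1)%R.
  exists (maxn m1 m2) => //; rewrite /F /= in_itv/=; apply/andP; split.
    rewrite -[leRHS]invrK lef_pV2 ?posrE ?exprn_gt0 ?invr_gt0//.
    by rewrite ltW// hm2// leq_maxr.
  by rewrite hm1// leq_maxl.
have ndF : nondecreasing_seq F.
  move=> m k mk; rewrite subsetEset => z; rewrite /F /= !in_itv/=.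
  have : (2 ^+ m <= 2 ^+ k :> R)%R by rewrite ler_weXn2l// ler1n.
  move=> h1 /andP[h2 h3]; rewrite (lt_le_trans h3 h1) andbT.
  by apply: le_trans h2; rewrite lef_pV2 ?posrE ?exprn_gt0.
rewrite FE.
have := @ge0_nondecreasing_set_cvg_integral _ (measurableTypeR R) R F h
  (@lebesgue_measure R) ndF.
have mF i : measurable (F i) by exact: measurable_itv.
have Fh i : measurable_fun (F i) h.
  by apply: mhs => //; exact: sub_pos.
have Fh0 i x : F i x -> 0 <= h x.
  by move=> Fx; apply: h0; have := sub_pos (p0 i) Fx; rewrite /= in_itv/= andbT.
move=> /(_ mF Fh Fh0) /cvg_lim <- //.
have Dg : (fun m => (D + g m)%:E) @ \oo --> D%:E.
  apply: cvg_EFin; first by near=> m.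
  rewrite -[X in _ --> X]addr0; apply: cvgD => //; exact: cvg_cst.
have <- := cvg_lim (@ereal_hausdorff R) Dg.
apply: lee_lim.
- apply: ereal_nondecreasing_is_cvgn.
  exact: ge0_nondecreasing_set_nondecreasing_integral.
- by apply/cvg_ex; exists D%:E.
- by near=> m; exact: hD.
Unshelve. all: by end_near. Qed.

End Pieces.

(** * Dyadic level sets and the lower bound for the seminorm *)

Section Levels.
Context {R : realType}.

(** [fine] would send an infinite measure to 0; [distrib_level] excludes this when [distrib u] is
    finite at positive heights. *)
Definition level n (u : 'rV[R]_n -> \bar R) (l0 : R) (k : nat) : R :=
  fine (distrib u (l0 * 2 ^+ k)).

Lemma level_ge0 n (u : 'rV[R]_n -> \bar R) l0 k : 0 <= level u l0 k.
Proof. by rewrite fine_ge0// distrib_ge0. Qed.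

Lemma distrib_level n (u : 'rV[R]_n -> \bar R) l0 k : 0 < l0 ->
  (forall b, 0 < b -> (distrib u b < +oo)%E) ->
  distrib u (l0 * 2 ^+ k) = (level u l0 k)%:E.
Proof.
move=> l00 uoo; rewrite /level fineK// ge0_fin_numE ?distrib_ge0// uoo//.
by rewrite mulr_gt0// exprn_gt0.
Qed.

Lemma le_level n (u : 'rV[R]_n -> \bar R) l0 k : 0 < l0 ->
  (forall b, 0 < b -> (distrib u b < +oo)%E) ->
  level u l0 k.+1 <= level u l0 k.
Proof.
move=> l00 uoo; rewrite -lee_fin -!distrib_level//; apply: le_distrib.
by rewrite ler_pM2l// exprS ler_peMl ?exprn_ge0// ler1n.
Qed.

Lemma distrib_quotient_level n (s beta : R) : 0 < s -> 0 < beta ->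
  exists2 c : R, 0 < c &
  forall (u : 'rV[R]_n.+1 -> \bar R) l0 k, 0 < l0 ->
  (forall b, 0 < b -> (distrib u b < +oo)%E) -> 0 < level u l0 k ->
  ((level u l0 k * level u l0 k.+1)%:E <=
   distrib (quotient (n.+1%:R / s + beta) u)
    (l0 * 2 ^+ k.+1 * c * level u l0 k `^ (- (s^-1 + beta / n.+1%:R))))%E.
Proof.
move=> s0 beta0; set e := _ / s + beta.
have e0 : 0 < e by rewrite addr_gt0// divr_gt0.
pose kappa : R := Num.sqrt n.+1%:R * (2 `^ (n.+1%:R^-1) / 2).
have kappa0 : 0 < kappa.
  by rewrite mulr_gt0 ?sqrtr_gt0// divr_gt0// powR_gt0.
(* The factor 1/2 appears because the gap between consecutive thresholds is half of the upper
   one. *)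
exists (2^-1 * kappa `^ (- e)); first by rewrite mulr_gt0 ?powR_gt0 ?invr_gt0.
move=> u l0 k l00 uoo ak.
have lk : l0 * 2 ^+ k < l0 * 2 ^+ k.+1.
  by rewrite ltr_pM2l// exprS ltr_pMl ?exprn_gt0// ltr1n.
have := distrib_quotient (ltW e0) lk ak (distrib_level k l00 uoo).
rewrite distrib_level// -EFinM.
congr (_ <= distrib _ _)%E.
rewrite (_ : Num.sqrt _ * _ = kappa * level u l0 k `^ n.+1%:R^-1); last first.
  by rewrite /kappa powRM ?(ltW ak)//; ring.
rewrite powRM ?powR_ge0 ?(ltW kappa0)// -powRrM.
rewrite (_ : n.+1%:R^-1 * - e = - (s^-1 + beta / n.+1%:R)); last first.
  by rewrite /e; field; rewrite (gt_eqF s0) andbT gt_eqF// ltr_pwDl// ler0n.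
by rewrite exprS; field.
Qed.

Lemma lorentz_ge0 n s r (f : 'rV[R]_n -> \bar R) : (0 <= lorentz s r f)%E.
Proof.
case: r => [r| |] //=; first exact: poweR_ge0.
apply: (@le_trans _ _ (1%:E * poweR (distrib f 1) s^-1)%E).
  by rewrite mule_ge0 ?poweR_ge0.
by apply: ereal_sup_ubound; exists 1 => //=; rewrite in_itv/= ltr01.
Qed.

(** At the threshold [b k] of [distrib_quotient_level], the quantity [b * distrib ^ (1/s)] is at
    least [c * levG]. For infinite [r] this is one competitor in the supremum; for finite [r] the
    bound persists up to constants on the interval from [b k / 2] to [b k], and these intervals are
    disjoint. *)
Lemma levG_le_seminorm n (s beta : R) (r : \bar R) :
  0 < s -> 0 < beta -> (0%:E < r)%E ->
  exists2 C : R, 0 < C &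
  forall (u : 'rV[R]_n.+1 -> \bar R) l0 K, 0 < l0 ->
  (forall b, 0 < b -> (distrib u b < +oo)%E) ->
  (gag_seminorm beta s r u < +oo)%E ->
  seqnorm_le r (C * fine (gag_seminorm beta s r u)) K
    (levG l0 s^-1 (beta / n.+1%:R) (level u l0)).
Proof.
move=> s0 beta0 r0.
have [c c0 cP] := @distrib_quotient_level n s beta s0 beta0.
pose A := beta / n.+1%:R.
have A0 : 0 < A by rewrite divr_gt0.
have is0 : 0 < s^-1 by rewrite invr_gt0.
pose b (u : 'rV[R]_n.+1 -> \bar R) l0 k :=
  l0 * 2 ^+ k.+1 * c * level u l0 k `^ (- (s^-1 + A)).
have b0 u l0 k : 0 < l0 -> 0 < level u l0 k -> 0 < b u l0 k.
  by move=> l00 ak; rewrite !mulr_gt0 ?powR_gt0 ?exprn_gt0.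
have bG u l0 k : 0 < level u l0 k ->
    b u l0 k * (level u l0 k * level u l0 k.+1) `^ s^-1 =
    c * levG l0 s^-1 A (level u l0) k.
  move=> ak; rewrite /b /levG powRM ?level_ge0//.
  rewrite (_ : - (s^-1 + A) = - A - s^-1); last by ring.
  rewrite powRB; last by rewrite (gt_eqF ak) implybT.
  by field; rewrite gt_eqF// powR_gt0.
case: r r0 => [r| |] //; last first.
  move=> _; exists c^-1; first by rewrite invr_gt0.
  move=> u l0 K l00 uoo; set N := gag_seminorm _ _ _ _ => Noo k _.
  have N0 : (0 <= N)%E by exact: lorentz_ge0.
  have Nf : N \is a fin_num by rewrite ge0_fin_numE.
  rewrite -/A mulrC ler_pdivlMr//.
  have [a0|ak] := leP (level u l0 k) 0.
    rewrite /levG (_ : level u l0 k = 0) ?powR0 ?oppr_eq0 ?gt_eqF//.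
      by rewrite mulr0 mul0r fine_ge0.
    by apply/le_anti; rewrite a0 level_ge0.
  rewrite mulrC -bG// -lee_fin fineK//.
  apply: (@le_trans _ _ ((b u l0 k)%:E *
      poweR (distrib (quotient (n.+1%:R / s + beta) u) (b u l0 k)) s^-1)%E).
    rewrite EFinM; apply: lee_wpmul2l; first by rewrite lee_fin ltW// b0.
    rewrite -poweR_EFin; apply: gt0_ler_poweR; rewrite ?(ltW is0)//.
    - by rewrite in_itv/= leey andbT lee_fin mulr_ge0 ?level_ge0.
    - by rewrite in_itv/= leey andbT distrib_ge0.
    - exact: cP.
  by apply: ereal_sup_ubound; exists (b u l0 k) => //=; rewrite in_itv/= andbT b0.
rewrite lte_fin => r0.
have ir0 : 0 < r^-1 by rewrite invr_gt0.
(* This undoes the factor [s] of the norm and the constants 1/2 and [(c / 2) ^ r] in the pieces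
   [d k]. *)
pose D : R := 2 / s * (2 / c) `^ r.
have D0 : 0 < D by rewrite !mulr_gt0 ?invr_gt0 ?powR_gt0 ?divr_gt0.
exists (D `^ r^-1); first exact: powR_gt0.
move=> u l0 K l00 uoo.
rewrite /gag_seminorm /= -/(quotient (n.+1%:R / s + beta) u).
rewrite -/(lorentz_integrand s r (quotient (n.+1%:R / s + beta) u)).
set f := quotient _ u; set h := lorentz_integrand _ _ _.
set I := (\int[_]_(_ in _) _)%E => Noo.
have h0 x : 0 < x -> (0 <= h x)%E by exact: lorentz_integrand_ge0.
have mh := measurable_lorentz_integrand s r f : measurable_fun _ h.
have I0 : (0 <= I)%E.
  by apply: integral_ge0 => x /=; rewrite in_itv/= andbT; exact: h0.
have If : I \is a fin_num.
  rewrite ge0_fin_numE// ltey; apply/negP => /eqP Ioo; move: Noo.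
  by rewrite Ioo gt0_muley ?lte_fin// poweRyr ?gt_eqF// ltxx.
have -> : (D `^ r^-1 * fine (poweR (s%:E * I)%E r^-1)) `^ r = D * (s * fine I).
  have sI : 0 <= s * fine I by rewrite mulr_ge0 ?fine_ge0// ltW.
  rewrite -(fineK If) -EFinM /= powRM ?powR_ge0// -!powRrM mulVf ?gt_eqF//.
  by rewrite !powRr1// ltW.
pose d k := 2^-1 * (c / 2 * levG l0 s^-1 A (level u l0) k) `^ r.
suff : (\sum_(k < K) (d k)%:E <= I)%E.
  rewrite sumEFin -[X in (_ <= X)%E](fineK If) lee_fin /d => dI.
  have -> : D * (s * fine I) = 2 * (2 / c) `^ r * fine I.
    by rewrite /D; field; rewrite gt_eqF.
  apply: le_trans (ler_wpM2l _ dI); last by rewrite mulr_ge0 ?powR_ge0.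
  rewrite mulr_sumr; apply: ler_sum => k _; rewrite -/A.
  rewrite [(c / 2 * _) `^ r]powRM ?levG_ge0 ?divr_ge0 ?(ltW c0)//.
  set P := (2 / c) `^ r; set Q := (c / 2) `^ r; set G := levG _ _ _ _ _ `^ r.
  rewrite (_ : 2 * P * (2^-1 * (Q * G)) = P * Q * G); last by field.
  rewrite /P /Q -powRM ?divr_ge0 ?(ltW c0)//.
  rewrite (_ : 2 / c * (c / 2) = 1); last by field; rewrite gt_eqF.
  by rewrite (congr1 (@^~ r) (@powR1 R)) mul1r.
elim: K => [|K IH]; first by rewrite big_ord0.
(* If the last level is zero, its term vanishes because zero to a nonzero power, even a negative
   one, is zero. Otherwise all earlier levels are positive, and so are the thresholds. *)
have [aK|aK] := leP (level u l0 K) 0.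
  rewrite big_ord_recr /= [X in (_ + X)%E](_ : _ = 0%E) ?adde0//.
  rewrite /d /levG (_ : level u l0 K = 0); last first.
    by apply/le_anti; rewrite aK level_ge0.
  rewrite [0 `^ (- A)]powR0 ?oppr_eq0 ?gt_eqF//.
  by rewrite !mulr0 powR0 ?gt_eqF// mulr0.
have ak k : (k <= K)%N -> 0 < level u l0 k.
  move=> kK; apply: (lt_le_trans aK).
  rewrite -(subnK kK); elim: (K - k)%N => [//|j]; apply: le_trans.
  by rewrite addSn le_level.
apply: (@sum_le_integral _ h mh h0 (b u l0) (fun k => (d k)%:E)) => [k kK|k kK|k kK].
- exact/b0/ak.
(* The thresholds at least double: the dyadic factor doubles, and the nonincreasing levels carry a
   negative exponent. *)
- rewrite /b [in leRHS]exprS [2 * 2 ^+ _]mulrC.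
  rewrite (_ : l0 * (2 ^+ k.+1 * 2) * c * _ =
    2 * (l0 * 2 ^+ k.+1 * c * level u l0 k.+1 `^ (- (s^-1 + A)))); last by ring.
  rewrite !ler_pM2l ?mulr_gt0 ?exprn_gt0//.
  rewrite !powRN lef_pV2 ?posrE ?powR_gt0 ?ak// 1?ltnW//.
  apply: ge0_ler_powR; rewrite ?nnegrE ?level_ge0 ?addr_ge0 ?(ltW is0) ?(ltW A0)//.
  exact: le_level.
- have bk := b0 u l0 k l00 (ak k kK).
  have aa : 0 <= level u l0 k * level u l0 k.+1 by rewrite mulr_ge0 ?level_ge0.
  (* A lower bound for the integrand on the piece: the height is at least [b / 2], its reciprocal at
     least [1 / b], and [distrib] at least its value at [b]. *)
  pose m := (b u l0 k / 2 * (level u l0 k * level u l0 k.+1) `^ s^-1) `^ r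
    / b u l0 k.
  have -> : d k = m * (b u l0 k - b u l0 k / 2).
    rewrite /d /m (_ : b u l0 k / 2 * _ =
      c / 2 * levG l0 s^-1 A (level u l0) k); last first.
      by rewrite mulrAC bG; [field|exact: ak].
    by rewrite /d; field; rewrite gt_eqF.
  apply: integral_ge_piece => //.
  + by rewrite divr_gt0.
  + by rewrite ler_pdivrMr// ler_pMr// ler1n.
  + by rewrite /m divr_ge0 ?powR_ge0// ltW.
  move=> z /andP[z1 z2].
  have z0 : 0 < z by apply: lt_le_trans z1; rewrite divr_gt0.
  rewrite /h /lorentz_integrand /m EFinM.
  apply: lee_pmul; rewrite ?lee_fin ?powR_ge0 ?invr_ge0 ?(ltW bk)//; last first.
    by rewrite lef_pV2 ?posrE// ltW.
  rewrite -poweR_EFin; apply: gt0_ler_poweR; rewrite ?(ltW r0)//.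
  + by rewrite in_itv/= leey andbT lee_fin mulr_ge0 ?powR_ge0// divr_ge0// ltW.
  + by rewrite in_itv/= leey andbT mule_ge0 ?poweR_ge0// lee_fin ltW.
  rewrite EFinM; apply: lee_pmul; rewrite ?lee_fin ?powR_ge0 ?divr_ge0 ?(ltW bk)//.
  rewrite -poweR_EFin; apply: gt0_ler_poweR; rewrite ?(ltW is0)//.
  + by rewrite in_itv/= leey andbT lee_fin.
  + by rewrite in_itv/= leey andbT distrib_ge0.
  apply: (le_trans (cP _ _ _ l00 uoo (ak k kK))).
  by apply: le_distrib; exact: ltW.
Qed.

End Levels.

(** * The Lorentz norm bounded by the level sequence *)

Section Upper.
Context {R : realType}.

(** The norm is discretised at heights [l0 * 2 ^ k]. The head is at most [l0 * V ^ (1/s)], so it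
    vanishes as [l0] tends to 0 and [V] leaves no trace in the bound. *)
Lemma lorentz_le_levF n (s : R) (r : \bar R) (e A : R) :
  0 < s -> e - A = s^-1 -> (0%:E < r)%E ->
  exists2 C : R, 0 < C &
  forall (u : 'rV[R]_n -> \bar R) (V N : R),
  (forall b, 0 < b -> (distrib u b <= V%:E)%E) -> 0 <= N ->
  (forall l0 K, 0 < l0 -> seqnorm_le_head r N K (levF l0 e A (level u l0))) ->
  (lorentz s r u <= (C * N)%:E)%E.
Proof.
move=> s0 eA r0; have is0 : 0 < s^-1 by rewrite invr_gt0.
have uooV (u : 'rV[R]_n -> \bar R) V :
    (forall b, 0 < b -> (distrib u b <= V%:E)%E) ->
    forall b, 0 < b -> (distrib u b < +oo)%E.
  by move=> uV b b0; apply: le_lt_trans (uV b b0) (ltry _).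
have levelV (u : 'rV[R]_n -> \bar R) V l0 k : 0 < l0 ->
    (forall b, 0 < b -> (distrib u b <= V%:E)%E) ->
    level u l0 k <= V.
  move=> l00 uV; rewrite -lee_fin -distrib_level//; last exact: uooV uV.
  by apply: uV; rewrite mulr_gt0// exprn_gt0.
have F0V (u : 'rV[R]_n -> \bar R) V l0 : 0 < l0 ->
    (forall b, 0 < b -> (distrib u b <= V%:E)%E) ->
    levF l0 e A (level u l0) 0 <= l0 * V `^ s^-1.
  move=> l00 uV; rewrite /levF expr0 mulr1 eA ler_pM2l//.
  have lV := levelV u V l0 0%N l00 uV.
  by apply: ge0_ler_powR; rewrite ?nnegrE ?level_ge0 ?(ltW is0)//
    (le_trans _ lV)// level_ge0.
case: r r0 => [r| |] //; last first.
  move=> _; exists 1 => // u V N uV N0 hF; rewrite mul1r.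
  apply: ge_ereal_sup => w [b /=]; rewrite in_itv/= andbT => b0 <-.
  set y := (b%:E * _)%E.
  have bE K : b / 2 ^+ K * 2 ^+ K = b by rewrite divfK// gt_eqF// exprn_gt0.
  have yE K : y = (levF (b / 2 ^+ K) e A (level u (b / 2 ^+ K)) K)%:E.
    have l0 : 0 < b / 2 ^+ K by rewrite divr_gt0// exprn_gt0.
    rewrite /levF bE eA EFinM -poweR_EFin -distrib_level ?bE//.
    exact: uooV uV.
  rewrite (yE 0%N) lee_fin leNgt; apply/negP => Ny.
  set z := levF _ _ _ _ _ in Ny.
  have z0 : 0 < z by exact: le_lt_trans Ny.
  (* Starting at [b / 2 ^ K] makes [b] the [K]-th height. As [z] exceeds [N], only the head can
     bound it, and the head is of order [2 ^ (- K)]. *)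
  have zK K : z * 2 ^+ K <= b * V `^ s^-1.
    have l0 : 0 < b / 2 ^+ K by rewrite divr_gt0// exprn_gt0.
    have := hF _ K l0 K (leqnn K).
    have -> : levF (b / 2 ^+ K) e A (level u (b / 2 ^+ K)) K = z.
      by have := yE K; rewrite (yE 0%N) => -[].
    rewrite le_max [z <= N]leNgt Ny orbF => zF.
    rewrite -ler_pdivlMr ?exprn_gt0//; apply: (le_trans zF).
    by apply: le_trans (F0V _ V _ l0 uV) _; rewrite mulrAC.
  have := archi_boundP (normr_ge0 (b * V `^ s^-1 / z)).
  set K := Num.bound _; apply/negP; rewrite -leNgt.
  apply: le_trans (ler_norm _); rewrite ler_pdivlMr// mulrC.
  apply: le_trans (zK K); rewrite ler_pM2l// -natrX ler_nat.
  by rewrite ltnW// ltn_expl.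
rewrite lte_fin => r0.
have ir0 : 0 < r^-1 by rewrite invr_gt0.
exists ((s * 2 `^ r) `^ r^-1); first by rewrite powR_gt0// mulr_gt0// powR_gt0.
move=> u V N uV N0 hF /=.
rewrite -/(lorentz_integrand s r u).
set h := lorentz_integrand _ _ _.
set I := (\int[_]_(_ in _) _)%E.
have h0 x : 0 < x -> (0 <= h x)%E by exact: lorentz_integrand_ge0.
have mh := measurable_lorentz_integrand s r u : measurable_fun _ h.
have I0 : (0 <= I)%E.
  by apply: integral_ge0 => x /=; rewrite in_itv/= andbT; exact: h0.
have uoo := uooV u V uV.
have piece l0 k : 0 < l0 ->
    (\int[lebesgue_measure]_(z in `[(l0 * 2 ^+ k)%R, (l0 * 2 ^+ k.+1)%R[) h z <=
     ((2 * levF l0 e A (level u l0) k) `^ r)%:E)%E.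
  move=> l00; set x := l0 * 2 ^+ k.
  have x0 : 0 < x by rewrite mulr_gt0// exprn_gt0.
  have x2 : l0 * 2 ^+ k.+1 = 2 * x by rewrite /x exprS mulrCA.
  rewrite x2.
  pose m := (2 * levF l0 e A (level u l0) k) `^ r / x.
  have -> : (2 * levF l0 e A (level u l0) k) `^ r = m * (2 * x - x).
    by rewrite /m; field; rewrite gt_eqF.
  apply: integral_le_piece => //; first by lra.
  move=> z /andP[xz zx].
  have z0 : 0 < z by exact: lt_le_trans xz.
  rewrite /h /lorentz_integrand /m EFinM.
  apply: lee_pmul; rewrite ?poweR_ge0 ?lee_fin ?invr_ge0 ?(ltW z0)//; last first.
    by rewrite lef_pV2 ?posrE.
  rewrite -poweR_EFin; apply: gt0_ler_poweR; rewrite ?(ltW r0)//.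
  + by rewrite in_itv/= leey andbT mule_ge0 ?poweR_ge0// lee_fin ltW.
  + by rewrite in_itv/= leey andbT lee_fin (mulr_ge0 _ (levF_ge0 _ _ _ _ l00)).
  rewrite /levF mulrA EFinM; apply: lee_pmul; rewrite ?poweR_ge0 ?lee_fin ?(ltW z0)
    ?(ltW zx)//.
  rewrite eA -poweR_EFin -distrib_level//.
  apply: gt0_ler_poweR; rewrite ?(ltW is0)//.
  + by rewrite in_itv/= leey andbT distrib_ge0.
  + by rewrite in_itv/= leey andbT distrib_ge0.
  exact: le_distrib.
(* The contribution of the head for [l0 = 2 ^ (- m)], a geometric sequence in [m]. *)
pose g (m : nat) := 2 `^ r * (2 * ((2 ^+ m)^-1 * V `^ s^-1) `^ r).
have IN : (I <= (2 `^ r * N `^ r)%:E)%E.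
  apply: (@integral_dyadic_le _ h mh h0 g) => [|m].
    pose z := (2^-1 : R) `^ r.
    have zlt : `|z| < 1.
      rewrite ger0_norm ?powR_ge0// -[ltRHS](congr1 (@^~ r) (@powR1 R)).
      by apply: gt0_ltr_powR; rewrite ?nnegrE// invf_lt1// ltr1n.
    have -> : g = (fun m => (2 `^ r * 2 * (V `^ s^-1) `^ r) * z ^+ m).
      apply/funext => m; rewrite /g powRM ?powR_ge0 ?invr_ge0 ?exprn_ge0//.
      rewrite (_ : (2 ^+ m)^-1 `^ r = z ^+ m); first by ring.
      by rewrite /z -exprVn -!powR_mulrn ?invr_ge0 ?powR_ge0// -!powRrM mulrC.
    rewrite -[X in _ --> X](mulr0 (2 `^ r * 2 * (V `^ s^-1) `^ r)).
    by apply: cvgM; [exact: cvg_cst|exact: cvg_expr].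
  set l0 := (2 ^+ m)^-1 : R.
  have l00 : 0 < l0 by rewrite invr_gt0 exprn_gt0.
  have -> : 2 ^+ m = l0 * 2 ^+ (m + m) :> R.
    by rewrite /l0 exprD mulKf// gt_eqF// exprn_gt0.
  have := @integral_le_sum _ h mh h0 l0
    (fun k => ((2 * levF l0 e A (level u l0) k) `^ r)%:E) (m + m)%N l00.
  move=> /(_ (fun k _ => piece l0 k l00)) /le_trans; apply.
  rewrite sumEFin lee_fin.
  have F0 k : 0 <= levF l0 e A (level u l0) k by exact: levF_ge0.
  rewrite (eq_bigr (fun k : 'I_(m + m) =>
    2 `^ r * levF l0 e A (level u l0) k `^ r)); last first.
    by move=> k _; rewrite powRM.
  rewrite -mulr_sumr -mulrDr ler_pM2l ?powR_gt0// addrC.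
  apply: (@le_trans _ _ (\sum_(k < (m + m).+1) levF l0 e A (level u l0) k `^ r)).
    by rewrite big_ord_recr /= lerDl powR_ge0.
  apply: (le_trans (hF l0 (m + m)%N l00)); rewrite lerD2r ler_pM2l//.
  have Fle := F0V u V l0 l00 uV.
  by apply: ge0_ler_powR; rewrite ?nnegrE ?(ltW r0) ?F0// (le_trans _ Fle).
have -> : ((s * 2 `^ r) `^ r^-1 * N)%:E = poweR (s%:E * (2 `^ r * N `^ r)%:E)%E r^-1.
  rewrite -EFinM poweR_EFin mulrA [in RHS]powRM
    ?powR_ge0 ?mulr_ge0 ?powR_ge0 ?(ltW s0)//.
  by rewrite -[(N `^ r) `^ _]powRrM divff ?gt_eqF// powRr1.
apply: gt0_ler_poweR; rewrite ?(ltW ir0)//.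
- by rewrite in_itv/= leey andbT mule_ge0// lee_fin ltW.
- by rewrite in_itv/= leey andbT lee_fin !mulr_ge0 ?powR_ge0// ltW.
- by apply: lee_wpmul2l => //; rewrite lee_fin ltW.
Qed.

End Upper.

(** * Bounded supports and the interpolation inequality *)

Lemma bounded_subset_box (R : realType) n (A : set 'rV[R]_n) :
  bounded_set (A : set (Rn R n)) ->
  exists M : R, A `<=` box (const_mx (- M)) (const_mx M).
Proof.
move=> /pinfty_ex_gt0[M M0 AM]; exists M => x Ax i; rewrite !mxE -ler_norml.
apply: le_trans (AM x Ax).
by rewrite [leRHS]/Num.norm /= mx_normrE; apply/bigmax_geP; right; exists (0, i).
Qed.

Unset Implicit Arguments.

Theorem theorem4p2 (R : realType) (n : nat) (Omega : set 'rV[R]_n)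
  (p alpha1 alpha2 alpha3 q1 q2 q3 theta : R) (t1 t2 t3 : \bar R)
  (Lam alpha : R) (k : 'rV[R]_n -> 'rV[R]_n -> R) :
  (1 <= n)%N ->
  open (Omega : set (Rn R n)) -> bounded_set (Omega : set (Rn R n)) ->
  1 < p < 2 ->
  0 < alpha1 < 1 -> 0 < alpha2 < 1 -> 0 < alpha3 < 1 ->
  p - 1 < q1 < 1 -> p - 1 < q2 < 1 -> p - 1 < q3 < 1 ->
  ((p - 1)%:E < t1)%E -> ((p - 1)%:E < t2)%E -> ((p - 1)%:E < t3)%E ->
  0 < theta < 1 ->
  alpha1 = (1 - theta) * alpha2 + theta * alpha3 ->
  q1^-1 = (1 - theta) / q2 + theta / q3 ->
  einv t1 = (1 - theta) * einv t2 + theta * einv t3 ->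
  1 <= Lam -> 0 < alpha < 1 -> kernel_adm Lam alpha p k ->
  exists C : R, 0 < C /\
    forall u : 'rV[R]_n -> \bar R,
      (forall x, u x != -oo%E) ->
      superharmonic p alpha k Omega u ->
      (forall x, ~ Omega x -> u x = 0%E) ->
      (gag_seminorm alpha2 q2 t2 u < +oo)%E ->
      (gag_seminorm alpha3 q3 t3 u < +oo)%E ->
      (lorentz (n%:R * q1 / (n%:R - alpha1 * q1)) t1 u <=
        C%:E * poweR (gag_seminorm alpha2 q2 t2 u) (1 - theta)
             * poweR (gag_seminorm alpha3 q3 t3 u) theta)%E.
Proof.
case: n Omega k => [//|n] Omega k _ _ Omega_bounded /andP[p1 _].
move=> /andP[a1_gt0 a1_lt1] /andP[a2_gt0 _] /andP[a3_gt0 _].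
move=> /andP[pq1 q1_lt1] /andP[pq2 _] /andP[pq3 _] pt1 pt2 pt3 theta01.
move=> alphaE qE tE _ _ _.
have p1_gt0 : 0 < p - 1 by rewrite subr_gt0.
have [q1_gt0 q2_gt0 q3_gt0] : [/\ 0 < q1, 0 < q2 & 0 < q3].
  by split; exact: lt_trans p1_gt0 _.
have [t1_gt0 t2_gt0 t3_gt0] : [/\ (0%:E < t1)%E, (0%:E < t2)%E & (0%:E < t3)%E].
  by split; apply: lt_trans pt1 || apply: lt_trans pt2 || apply: lt_trans pt3.
have [th_gt0 th_lt1] := andP theta01.
have n_gt0 : 0 < n.+1%:R :> R by [].
pose A1 := alpha1 / n.+1%:R; pose A2 := alpha2 / n.+1%:R.
pose A3 := alpha3 / n.+1%:R.
have [A1_gt0 A2_gt0 A3_gt0] : [/\ 0 < A1, 0 < A2 & 0 < A3].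
  by split; exact: divr_gt0.
have nq_gt0 : 0 < n.+1%:R - alpha1 * q1.
  rewrite subr_gt0; apply: (@lt_le_trans _ _ 1); last by rewrite ler1n.
  by rewrite mulr_ilt1// ltW.
pose s := n.+1%:R * q1 / (n.+1%:R - alpha1 * q1).
have s_gt0 : 0 < s by rewrite !mulr_gt0// invr_gt0.
(* The exponent of the level in [levF] is thus the one in the target Lorentz norm. *)
have sE : q1^-1 - A1 = s^-1.
  rewrite /s /A1; move: (n.+1%:R) n_gt0 nq_gt0 => w w_gt0 wq_gt0.
  by field; rewrite !gt_eqF.
have A1q : A1 < q1^-1 by rewrite -subr_gt0 sE invr_gt0.
have [C2 C2_gt0 lower2] := levG_le_seminorm n q2_gt0 a2_gt0 t2_gt0.
have [C3 C3_gt0 lower3] := levG_le_seminorm n q3_gt0 a3_gt0 t3_gt0.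
have [D D_gt0 middle] := levF_summation t1_gt0 A1_gt0 A1q.
have [U U_gt0 upper] := lorentz_le_levF n.+1 s_gt0 sE t1_gt0.
exists (U * D * (C2 `^ (1 - theta) * C3 `^ theta)).
split; first by rewrite !mulr_gt0 ?powR_gt0.
move=> u _ _ u0; set N2 := gag_seminorm _ _ _ _; set N3 := gag_seminorm _ _ _ _.
move=> N2_fin N3_fin.
have N2_ge0 : (0 <= N2)%E by exact: lorentz_ge0.
have N3_ge0 : (0 <= N3)%E by exact: lorentz_ge0.
have N2E : N2 = (fine N2)%:E by rewrite fineK// ge0_fin_numE.
have N3E : N3 = (fine N3)%:E by rewrite fineK// ge0_fin_numE.
have N2r : 0 <= fine N2 by rewrite fine_ge0.
have N3r : 0 <= fine N3 by rewrite fine_ge0.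
have [M OmegaM] := bounded_subset_box Omega_bounded.
(* As [u] vanishes off [Omega], this volume bounds every level set; it does not enter the
   constant. *)
pose V := boxvol (const_mx (- M) : 'rV[R]_n.+1) (const_mx M).
have uV b : 0 < b -> (distrib u b <= V%:E)%E.
  move=> b_gt0; apply: le_trans (lebo_le_boxvol _ _).
  apply: le_lebo => x /= bux; apply: OmegaM; apply: contrapT => /u0 ux.
  by move: bux; rewrite ux abse0 lte_fin ltNge ltW.
have uoo b : 0 < b -> (distrib u b < +oo)%E.
  by move=> b_gt0; apply: le_lt_trans (uV b b_gt0) (ltry _).
set X := C2 * fine N2; set Y := C3 * fine N3.
have X_ge0 : 0 <= X by rewrite mulr_ge0// ltW.
have Y_ge0 : 0 <= Y by rewrite mulr_ge0// ltW.
pose N := X `^ (1 - theta) * Y `^ theta.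
have N_ge0 : 0 <= N by rewrite mulr_ge0 ?powR_ge0.
have DN_ge0 : 0 <= D * N by rewrite mulr_ge0// ltW.
have := upper u V (D * N) uV DN_ge0.
have -> : (U * (D * N))%:E =
    ((U * D * (C2 `^ (1 - theta) * C3 `^ theta))%:E
       * poweR N2 (1 - theta) * poweR N3 theta)%E.
  rewrite N2E N3E !poweR_EFin -!EFinM /N /X /Y.
  by rewrite !powRM ?(ltW C2_gt0) ?(ltW C3_gt0)//; congr _%:E; ring.
apply=> l0 K l0_gt0.
apply: middle => //; [exact: level_ge0|by move=> j; exact: le_level|].
(* All three sequences use the same levels of [u], so the relations for [q] and [alpha] give an
   exact factorisation. *)
have -> : levG l0 q1^-1 A1 (level u l0) =
    (fun j => levG l0 q2^-1 A2 (level u l0) j `^ (1 - theta) *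
              levG l0 q3^-1 A3 (level u l0) j `^ theta).
  apply/funext => j; rewrite -levG_interp ?invr_gt0// qE.
  by congr levG; rewrite /A1 /A2 /A3 alphaE; ring.
apply: seqnorm_le_holder tE _ _ _ _ _ _ => //.
- by move=> j; exact: levG_ge0.
- by move=> j; exact: levG_ge0.
- exact: lower2.
- exact: lower3.
Qed.
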